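(* Let $\mathcal{L}$ be an expansion of $\mathcal{L}_{\mathrm{RV}}$ by constant symbols and by function and relation symbols not involving the sort $\mathrm{VF}$, and let $T$ be an $\mathcal{L}$-theory containing $T_{\mathrm{Hen},0}$. Then every existential $\mathcal{L}$-formula is equivalent modulo $T$ to an existential $\mathcal{L}$-formula without any quantifiers over the sort $\mathrm{VF}$.
   Context: For a valued field $K$ with valuation ring $\mathcal{O}_K$, maximal ideal $\mathcal{M}_K$, value group $\Gamma$ and valuation $\mathrm{ord}$, and a positive integer $N$, put $\mathrm{RV}_N^\times=K^\times/(1+N\mathcal{M}_K)$, $\mathrm{RV}_N=\mathrm{RV}_N^\times\cup\{0\}$, $\mathrm{rv}_N\colon K\to\mathrm{RV}_N$ the projection with $\mathrm{rv}_N(0)=0$ (and also the induced maps $\mathrm{RV}_M\to\mathrm{RV}_N$ for $N\mid M$). For $\xi_0,\dots,\xi_d\in\mathrm{RV}_N$ let $\sum_i\xi_i=\{\mathrm{rv}_N(\sum_i x_i)\mid x_i\in K,\mathrm{rv}_N(x_i)=\xi_i\}$; for $A\subseteq\mathrm{RV}_N$ write $\mathrm{ord}(A)\le\delta$ if every element of $A$ has order $\le\delta$. The multisorted language $\mathcal{L}_{\mathrm{RV}}$ has sorts $\mathrm{VF}$ and $\mathrm{RV}_N$ ($N\geq1$): the ring language on $\mathrm{VF}$; on each $\mathrm{RV}_N$ constants $0,1$, a binary function $\cdot$, a binary relation $\mid$ and a ternary relation $\oplus$; function symbols $\mathrm{rv}_N\colon\mathrm{VF}\to\mathrm{RV}_N$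 and $\mathrm{rv}_{N,M}\colon \mathrm{RV}_M\to\mathrm{RV}_N$ ($N\mid M$); relation symbols $P_{N,d}$ on $\mathrm{RV}_N\times\mathrm{RV}_{N^2}^{d+1}$. In a valued field these are interpreted naturally: $\cdot$ is the group multiplication on $\mathrm{RV}_N^\times$ extended by $0$, $1=\mathrm{rv}_N(1)$, $\mathrm{rv}_N(x)\mid\mathrm{rv}_N(y)$ iff $\mathrm{ord}\,x\le\mathrm{ord}\,y$, $\oplus(\xi_1,\xi_2,\xi_3)$ iff there are $x_i\in K$ with $\mathrm{rv}_N(x_i)=\xi_i$ and $x_1+x_2=x_3$, and $P_{N,d}(\xi,\zeta_0,\dots,\zeta_d)$ iff $\xi\in\mathrm{RV}_N^\times$ and for some (equivalently all) $a_i\in K$ with $\mathrm{rv}_{N^2}(a_i)=\zeta_i$: $\mathrm{ord}(\sum_{i=1}^d\mathrm{rv}_N(ia_i)\xi^{i-1})\le\min_{1\le i\le d}\mathrm{ord}(a_i\xi^{i-1})+\mathrm{ord}\,N$ and there is $\tilde\xi\in\mathrm{RV}_{N^2}$ with $\mathrm{rv}_N(\tilde\xi)=\xi$ and $0\in\sum_{i=0}^d\mathrm{rv}_{N^2}(a_i)\tilde\xi^i$. $T_{\mathrm{Hen},0}$ is the $\mathcal{L}_{\mathrm{RV}}$-theory of nontrivially valued Henselian valued fields of characteristic zero with this natural structure. An existential formula is one of the form $\exists y\,\varphi(x,y)$ with $\varphi$ quantifier-free. *)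

(* Defs.v *)
From HB Require Import structures.
From mathcomp Require Import all_boot all_order all_algebra.
Set Implicit Arguments. Unset Strict Implicit. Unset Printing Implicit Defensive.
Import Order.TTheory GRing.Theory Num.Theory.

(* Sorts: VF, and RV n standing for RV_{n+1} (so that N = n+1 >= 1).  *)
Inductive sort := VF | RV of nat.

Definition sort_eq_dec (s t : sort) : {s = t} + {s <> t}.
Proof. decide equality; case: (eqVneq n n0) => [->|h]; [by left|right=> E]; by move: h; rewrite E eqxx. Defined.

(* index of the sort RV_{N^2} when n indexes RV_N, N = n+1 *)
Definition sqi (n : nat) : nat := (n.+1 ^ 2).-1.

Inductive bfsym :=
| VFzero | VFone | VFadd | VFopp | VFmul
| RVzero of nat | RVone of nat | RVmul of nat
| Brv of nat
| Brvres (n m : nat) of (n.+1 %| m.+1).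

Definition bfargs (f : bfsym) : list sort :=
  match f with
  | VFzero | VFone => [::]
  | VFadd | VFmul => [:: VF; VF]
  | VFopp => [:: VF]
  | RVzero _ | RVone _ => [::]
  | RVmul n => [:: RV n; RV n]
  | Brv _ => [:: VF]
  | Brvres _ m _ => [:: RV m]
  end.

Definition bfres (f : bfsym) : sort :=
  match f with
  | VFzero | VFone | VFadd | VFopp | VFmul => VF
  | RVzero n | RVone n | RVmul n => RV n
  | Brv n => RV n
  | Brvres n _ _ => RV n
  end.

Inductive brsym := RVdvd of nat | RVoplus of nat | RVP (n d : nat).

Definition brargs (r : brsym) : list sort :=
  match r with
  | RVdvd n => [:: RV n; RV n]
  | RVoplus n => [:: RV n; RV n; RV n]
  | RVP n d => RV n :: nseq d.+1 (RV (sqi n))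
  end.

(* An expansion of L_RV by constant symbols (of any sort) and by function and
   relation symbols not involving the sort VF (all argument/result sorts are RV
   sorts, given by their index). *)
Record expansion := Expansion {
  ec : Type; ec_sort : ec -> sort;
  ef : Type; ef_args : ef -> list nat; ef_res : ef -> nat;
  er : Type; er_args : er -> list nat }.

Inductive fsym (E : expansion) := Fb of bfsym | Fc of ec E | Fx of ef E.
Inductive rsym (E : expansion) := Rb of brsym | Rx of er E.
Arguments Fb {E}. Arguments Fc {E}. Arguments Fx {E}.
Arguments Rb {E}. Arguments Rx {E}.

Definition fargs E (f : fsym E) : list sort :=
  match f with Fb g => bfargs g | Fc _ => [::] | Fx g => map RV (ef_args g) end.
Definition fres E (f : fsym E) : sort :=
  match f with Fb g => bfres g | Fc c => ec_sort c | Fx g => RV (ef_res g) end.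
Definition rargs E (r : rsym E) : list sort :=
  match r with Rb g => brargs g | Rx g => map RV (er_args g) end.

Definition Lbase : expansion :=
  @Expansion Empty_set (fun e => match e with end)
             Empty_set (fun e => match e with end) (fun e => match e with end)
             Empty_set (fun e => match e with end).

Section Syntax.
Variable E : expansion.

Inductive term : sort -> Type :=
| tvar (s : sort) (k : nat) : term s
| tapp (f : fsym E) : targs (fargs f) -> term (fres f)
with targs : list sort -> Type :=
| tnil : targs [::]
| tcons (s : sort) (ss : list sort) : term s -> targs ss -> targs (s :: ss).

Inductive formula :=
| Ftrue | Ffalse
| Feq (s : sort) (t u : term s)
| Frel (r : rsym E) (ts : targs (rargs r))
| Fnot (p : formula)
| Fand (p q : formula)
| For (p q : formula)
| Fex (s : sort) (k : nat) (p : formula)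
| Fall (s : sort) (k : nat) (p : formula).

Fixpoint qf (p : formula) : bool :=
  match p with
  | Fex _ _ _ | Fall _ _ _ => false
  | Fnot q => qf q
  | Fand q r | For q r => qf q && qf r
  | _ => true
  end.

Fixpoint existential (p : formula) : bool :=
  match p with Fex _ _ q => existential q | _ => qf p end.

Definition is_VF (s : sort) : bool := if s is VF then true else false.

Fixpoint existential_noVF (p : formula) : bool :=
  match p with Fex s _ q => ~~ is_VF s && existential_noVF q | _ => qf p end.

Definition same_var (s : sort) (k : nat) (s' : sort) (k' : nat) : bool :=
  (if sort_eq_dec s s' then true else false) && (k == k').

Fixpoint occ_term (s : sort) (k : nat) (s' : sort) (t : term s') : bool :=
  match t with
  | tvar s0 k0 => same_var s k s0 k0
  | tapp f ts => occ_targs s k ts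
  end
with occ_targs (s : sort) (k : nat) (ss : list sort) (ts : targs ss) : bool :=
  match ts with
  | tnil => false
  | tcons _ _ t ts' => occ_term s k t || occ_targs s k ts'
  end.

Fixpoint free (s : sort) (k : nat) (p : formula) : bool :=
  match p with
  | Ftrue | Ffalse => false
  | Feq _ t u => occ_term s k t || occ_term s k u
  | Frel _ ts => occ_targs s k ts
  | Fnot q => free s k q
  | Fand q r | For q r => free s k q || free s k r
  | Fex s' k' q | Fall s' k' q => ~~ same_var s k s' k' && free s k q
  end.

Definition sentence (p : formula) : Prop := forall s k, ~~ free s k p.

Fixpoint vals (C : sort -> Type) (ss : list sort) : Type :=
  match ss with [::] => unit | s :: ss' => (C s * vals C ss')%type end.

Record structure := Structure {
  car : sort -> Type;
  inh : forall s, car s;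
  fint : forall f : fsym E, vals car (fargs f) -> car (fres f);
  rint : forall r : rsym E, vals car (rargs r) -> Prop }.

Variable M : structure.

Definition assignment := forall s : sort, nat -> car M s.

Fixpoint eval_term (v : assignment) (s : sort) (t : term s) : car M s :=
  match t in term s0 return car M s0 with
  | tvar s0 k => v s0 k
  | tapp f ts => @fint M f (eval_targs v ts)
  end
with eval_targs (v : assignment) (ss : list sort) (ts : targs ss)
    : vals (car M) ss :=
  match ts in targs ss0 return vals (car M) ss0 with
  | tnil => tt
  | tcons _ _ t ts' => (eval_term v t, eval_targs v ts')
  end.

Definition upd (v : assignment) (s : sort) (k : nat) (a : car M s) : assignment :=
  fun s' j =>
    match sort_eq_dec s s' with
    | left e => if j == k then eq_rect s (car M) a s' e else v s' j
    | right _ => v s' j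
    end.

Fixpoint sat (v : assignment) (p : formula) : Prop :=
  match p with
  | Ftrue => True
  | Ffalse => False
  | Feq _ t u => eval_term v t = eval_term v u
  | Frel r ts => @rint M r (eval_targs v ts)
  | Fnot q => ~ sat v q
  | Fand q r => sat v q /\ sat v r
  | For q r => sat v q \/ sat v r
  | Fex s k q => exists a : car M s, sat (upd v k a) q
  | Fall s k q => forall a : car M s, sat (upd v k a) q
  end.

Definition models (p : formula) : Prop := forall v : assignment, sat v p.

End Syntax.
Arguments car : clear implicits. Arguments fint : clear implicits.
Arguments rint : clear implicits.


Arguments tvar {E}. Arguments tapp {E}. Arguments tnil {E}. Arguments tcons {E s ss}.
Arguments Ftrue {E}. Arguments Ffalse {E}.

Definition model (E : expansion) (T : formula E -> Prop) (M : structure E) :=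
  forall p, T p -> models M p.

Section Embed.
Variable E : expansion.

Fixpoint emb_term (s : sort) (t : term Lbase s) {struct t} : term E s :=
  match t in term _ s0 return term E s0 with
  | tvar s0 k => tvar s0 k
  | tapp f ts =>
      match f as f0 return targs Lbase (fargs f0) -> term E (fres f0) with
      | Fb g => fun ts0 => tapp (Fb g) (emb_targs ts0)
      | Fc c => fun _ => match c with end
      | Fx g => fun _ => match g with end
      end ts
  end
with emb_targs (ss : list sort) (ts : targs Lbase ss) {struct ts} : targs E ss :=
  match ts in targs _ ss0 return targs E ss0 with
  | tnil => tnil
  | tcons _ _ t ts' => tcons (emb_term t) (emb_targs ts')
  end.

Fixpoint embed (p : formula Lbase) : formula E :=
  match p with
  | Ftrue => Ftrue
  | Ffalse => Ffalse
  | Feq _ t u => Feq (emb_term t) (emb_term u)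
  | Frel r ts =>
      match r as r0 return targs Lbase (rargs r0) -> formula E with
      | Rb g => fun ts0 => @Frel E (Rb g) (emb_targs ts0)
      | Rx g => fun _ => match g with end
      end ts
  | Fnot q => Fnot (embed q)
  | Fand q r => Fand (embed q) (embed r)
  | For q r => For (embed q) (embed r)
  | Fex s k q => Fex s k (embed q)
  | Fall s k q => Fall s k (embed q)
  end.
End Embed.

Local Open Scope ring_scope.

Section Valued.
Variables (K : fieldType) (O : {pred K}).

Definition valuation_ring : Prop :=
  [/\ 1 \in O, {in O &, forall x y, x + y \in O},
      {in O, forall x, - x \in O}, {in O &, forall x y, x * y \in O} &
      forall x : K, x != 0 -> (x \in O) || (x^-1 \in O)].

Definition nontrivial : Prop := exists x : K, x \notin O.

Definition inM (x : K) : bool := (x \in O) && ((x == 0) || (x^-1 \notin O)).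

Definition unitO (x : K) : bool := [&& x != 0, x \in O & x^-1 \in O].

Definition henselian : Prop :=
  forall (p : {poly K}) (a : K),
    (forall i, p`_i \in O) -> a \in O -> inM p.[a] -> unitO (p^`()).[a] ->
    exists2 b, b \in O & (root p b /\ inM (b - a)).

Definition char0 : Prop := [pchar K] =i pred0.

(* ord u <= ord w  (ord 0 = +infinity) *)
Definition vle (u w : K) : bool := if u == 0 then w == 0 else w / u \in O.

(* rv_N x = rv_N y, with N = n+1, i.e. equality in K/(1 + N M_K) extended by 0 *)
Definition rv_eq (n : nat) (x y : K) : Prop :=
  (x == 0) = (y == 0) /\ (x != 0 -> inM ((y / x - 1) / n.+1%:R)).

(* first condition defining P_{N,d} (with representative x of xi and a_i):
   ord(sum_{i=1}^d rv_N(i a_i) xi^{i-1}) <= min_{1<=i<=d} ord(a_i xi^{i-1}) + ord N *)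
Definition Pcond1 (n d : nat) (x : K) (a : nat -> K) : Prop :=
  forall y : nat -> K,
    (forall i, (1 <= i <= d)%N -> rv_eq n (y i) (i%:R * a i * x ^+ i.-1)) ->
    forall i, (1 <= i <= d)%N ->
      vle (\sum_(1 <= j < d.+1) y j) (n.+1%:R * (a i * x ^+ i.-1)).

(* second condition: exists xi~ in RV_{N^2} over xi with
   0 in sum_{i=0}^d rv_{N^2}(a_i) xi~^i *)
Definition Pcond2 (n d : nat) (x : K) (a : nat -> K) : Prop :=
  exists xt : K, rv_eq n xt x /\
    exists z : nat -> K,
      (forall i, (i <= d)%N -> rv_eq (sqi n) (z i) (a i * xt ^+ i)) /\
      \sum_(0 <= i < d.+1) z i = 0.

End Valued.

Fixpoint mkvals (C : sort -> Type) (s : sort) (f : nat -> C s) (k : nat)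
  : vals C (nseq k s) :=
  match k return vals C (nseq k s) with
  | 0 => tt
  | k'.+1 => (f 0%N, mkvals (fun i => f i.+1) k')
  end.

(* M (an L-structure; only the L_RV-part is looked at) is, up to isomorphism,
   the natural L_RV-structure of a nontrivially valued Henselian field of
   characteristic zero. *)
Definition natural (E : expansion) (M : structure E) : Prop :=
  exists (K : fieldType) (O : {pred K}) (e : K -> car E M VF),
  let r n (x : K) : car E M (RV n) := fint E M (Fb (Brv n)) (e x, tt) in
  [/\ valuation_ring O, nontrivial O, henselian O, char0 K & bijective e] /\
  [/\ fint E M (Fb VFzero) tt = e 0, fint E M (Fb VFone) tt = e 1,
      forall x y, fint E M (Fb VFadd) (e x, (e y, tt)) = e (x + y),
      forall x, fint E M (Fb VFopp) (e x, tt) = e (- x) &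
      forall x y, fint E M (Fb VFmul) (e x, (e y, tt)) = e (x * y)] /\
  (forall n (xi : car E M (RV n)), exists x, r n x = xi) /\
  (forall n x y, r n x = r n y <-> rv_eq O n x y) /\
  (forall n, fint E M (Fb (RVzero n)) tt = r n 0) /\
  (forall n, fint E M (Fb (RVone n)) tt = r n 1) /\
  (forall n x y, fint E M (Fb (RVmul n)) (r n x, (r n y, tt)) = r n (x * y)) /\
  (forall n m (H : (n.+1 %| m.+1)%N) x,
      fint E M (Fb (Brvres H)) (r m x, tt) = r n x) /\
  (forall n xi1 xi2, rint E M (Rb (RVdvd n)) (xi1, (xi2, tt)) <->
      exists x y, [/\ xi1 = r n x, xi2 = r n y & vle O x y]) /\
  (forall n xi1 xi2 xi3, rint E M (Rb (RVoplus n)) (xi1, (xi2, (xi3, tt))) <->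
      exists x1 x2 x3,
        [/\ xi1 = r n x1, xi2 = r n x2, xi3 = r n x3 & x1 + x2 = x3]) /\
  (forall n d xi (zeta : vals (car E M) (nseq d.+1 (RV (sqi n)))),
      rint E M (Rb (RVP n d)) (xi, zeta) <->
      exists (x : K) (a : nat -> K),
        [/\ xi = r n x, zeta = mkvals (fun i => r (sqi n) (a i)) d.+1, x != 0,
            Pcond1 O n d x a & Pcond2 O n d x a]).

Definition THen0 (p : formula Lbase) : Prop :=
  sentence p /\ forall M : structure Lbase, natural M -> models M p.

(* Main.v *)
Require Import Defs.
From mathcomp Require Import all_boot all_order all_algebra.
From mathcomp Require Import ring zify.
From Stdlib Require Import Classical FunctionalExtensionality.

(* Elimination.  Fix y in K and a polynomial p.  By induction on the degree,
   applied to p', there is a centre b, either 0 or a root of some derivative of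
   p, at which the Taylor terms of p lose at most a fixed integer N (depending
   on the degree only) by cancellation when summed up at y: if the centre
   obtained for p' fails, then p(y) is so small that Newton's method provides
   a root of p close to y, which is a centre for p.  Moving a centre closer to
   y preserves this property, so finitely many polynomials have a common centre.
   Hence rv_m(p(y)) can be read off from rv_n of the Taylor coefficients at b
   and of y - b, and, for a root y of q, the predicate P_{n,d} says precisely
   that q has a root with given rv_n(y - b).  Reducing modulo the equation of b
   replaces y by a root of a polynomial of smaller degree, and the process
   terminates.  All RV-quantifiers introduced are existential.

   Transfer.  The class of natural structures need not be axiomatised: for
   polynomials with generic coefficients, the equivalence just obtained is
   itself a sentence of T_{Hen,0}, hence holds in every model of T.  In an
   arbitrary formula, VF occurs only inside terms rv_n(t) and equations between
   VF-terms, and the latter say rv_1(t - u) = 0. *)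

Set Implicit Arguments. Unset Strict Implicit. Unset Printing Implicit Defensive.
Import GRing.Theory.
Local Open Scope ring_scope.

(** * Valuations and Newton approximation *)

(** One formula has to serve all fields at once, and a nonzero integer may have positive valuation.
    So every loss by cancellation must be bounded by an integer depending on degrees alone. Two
    things contribute to it. Passing from $p$ to $p'$ multiplies the Taylor coefficient of index $j$
    by $j$, whence the factorials. If the linear Taylor term loses at most $N$ against the other
    terms of positive degree, Newton's method applies once $p(y)$ lies beyond $N$ times the linear
    term, hence possibly $N^2$ beyond the others. This explains the square in the recursion for the
    loss, and why $P_{N,d}$ looks at $\mathrm{RV}_{N^2}$ to describe roots in $\mathrm{RV}_N$.

    The formula stays existential because the RV-data at a centre certify themselves: any $b$ and
    any RV-values satisfying the stated relations yield a solution $y$. The construction of good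
    centres serves only for the converse, to show that such data exist whenever $y$ does.

    For the equation $q(y)=0$ a centre of $q'$ suffices, so every nonzero centre that occurs is a
    root of a polynomial of smaller size than $q$; this is what makes the induction close. *)

Section Valuation.
Variables (K : fieldType) (O : {pred K}).
Hypothesis VR : valuation_ring O.
Local Notation vle := (vle O).
Local Notation inM := (inM O).

Definition vlt (u w : K) := ~~ vle w u.
Lemma vltNge u w : vlt u w = ~~ vle w u. Proof. by []. Qed.

Lemma O_1 : 1 \in O. Proof. by case: VR. Qed.
Lemma O_D x y : x \in O -> y \in O -> x + y \in O.
Proof. by case: VR => _ h _ _ _; apply: h. Qed.
Lemma O_N x : x \in O -> - x \in O.
Proof. by case: VR => _ _ h _ _; apply: h. Qed.
Lemma O_M x y : x \in O -> y \in O -> x * y \in O.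
Proof. by case: VR => _ _ _ h _; apply: h. Qed.
Lemma O_V x : x != 0 -> (x \in O) || (x^-1 \in O).
Proof. by case: VR => _ _ _ _; apply. Qed.
Lemma O_0 : 0 \in O.
Proof. by rewrite -(addrN (1 : K)) O_D ?O_N ?O_1. Qed.
Lemma O_nat n : n%:R \in O.
Proof. by elim: n => [|n IH]; rewrite ?O_0 // -natr1 O_D ?O_1. Qed.
Lemma O_X x n : x \in O -> x ^+ n \in O.
Proof. by move=> hx; elim: n => [|n IH]; rewrite ?expr0 ?O_1 // exprS O_M. Qed.

Lemma vleP u w : reflect (exists2 c, c \in O & w = c * u) (vle u w).
Proof.
rewrite /Defs.vle; case: eqVneq => [->|u0].
  apply: (iffP eqP) => [->|[c _ ->]]; last by rewrite mulr0.
  by exists 1; rewrite ?O_1 ?mul1r.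
apply: (iffP idP) => [h|[c cO ->]]; last by rewrite mulfK.
by exists (w / u); rewrite ?divfK.
Qed.

Lemma vle_refl x : vle x x.
Proof. by apply/vleP; exists 1; rewrite ?O_1 ?mul1r. Qed.
Lemma vle_0 x : vle x 0.
Proof. by apply/vleP; exists 0; rewrite ?O_0 ?mul0r. Qed.
Lemma vle_0l x : vle 0 x = (x == 0).
Proof. by rewrite /Defs.vle eqxx. Qed.
Lemma vle_trans y x z : vle x y -> vle y z -> vle x z.
Proof.
move=> /vleP [c cO ->] /vleP [d dO ->]; apply/vleP; exists (d * c).
  exact: O_M.
by rewrite mulrA.
Qed.
Lemma vle_total x y : vle x y || vle y x.
Proof.
have [->|x0] := eqVneq x 0; first by rewrite vle_0 orbT.
have [->|y0] := eqVneq y 0; first by rewrite vle_0.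
rewrite /Defs.vle (negPf x0) (negPf y0).
by rewrite -[x / y]invrK invf_div O_V // mulf_neq0 ?invr_eq0.
Qed.
Lemma vle_D u x y : vle u x -> vle u y -> vle u (x + y).
Proof.
move=> /vleP [c cO ->] /vleP [d dO ->]; apply/vleP; exists (c + d).
  exact: O_D.
by rewrite mulrDl.
Qed.
Lemma vle_N u x : vle u (- x) = vle u x.
Proof.
suff h y : vle u y -> vle u (- y) by apply/idP/idP => /h //; rewrite opprK.
by move=> /vleP [c cO ->]; apply/vleP; exists (- c); rewrite ?O_N ?mulNr.
Qed.
Lemma vle_B u x y : vle u x -> vle u y -> vle u (x - y).
Proof. by move=> hx hy; rewrite vle_D ?vle_N. Qed.
Lemma vle_mul a b c d : vle a b -> vle c d -> vle (a * c) (b * d).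
Proof.
move=> /vleP [x xO ->] /vleP [y yO ->]; apply/vleP; exists (x * y).
  exact: O_M.
by rewrite mulrACA.
Qed.
Lemma vle_mul2l c a b : c != 0 -> vle (c * a) (c * b) = vle a b.
Proof.
move=> c0; apply/idP/idP => [/vleP [x xO e]|]; last exact: vle_mul (vle_refl c).
by apply/vleP; exists x => //; apply: (mulfI c0); rewrite e; ring.
Qed.
Lemma vle_Ml c x : c \in O -> vle x (c * x).
Proof. by move=> cO; apply/vleP; exists c. Qed.
Lemma vle_exp a b n : vle a b -> vle (a ^+ n) (b ^+ n).
Proof.
move=> h; elim: n => [|n IH]; first by rewrite !expr0 vle_refl.
by rewrite !exprS vle_mul.
Qed.
Lemma vle_sum I (r : seq I) (P : pred I) (F : I -> K) u :
  (forall i, P i -> vle u (F i)) -> vle u (\sum_(i <- r | P i) F i).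
Proof.
move=> h; apply: (big_ind (fun x => vle u x)) => //.
- exact: vle_0.
- exact: vle_D.
Qed.

Lemma vltW x y : vlt x y -> vle x y.
Proof. by rewrite /vlt; move/negPf => h; have := vle_total x y; rewrite h orbF. Qed.
Lemma vle_lt_trans y x z : vle x y -> vlt y z -> vlt x z.
Proof. by move=> h; apply: contra => h'; exact: vle_trans h' h. Qed.
Lemma vlt_le_trans y x z : vlt x y -> vle y z -> vlt x z.
Proof. by move=> h1 h2; apply: contra h1; exact: vle_trans h2. Qed.
Lemma vlt_neq0 x y : vlt x y -> x != 0.
Proof. by apply: contraNneq => ->; exact: vle_0. Qed.
Lemma vlt_0 x : x != 0 -> vlt x 0.
Proof. by rewrite /vlt vle_0l. Qed.
Lemma vlt_irr x : ~~ vlt x x.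
Proof. by rewrite /vlt vle_refl. Qed.
Lemma vlt_D u x y : vlt u x -> vlt u y -> vlt u (x + y).
Proof.
move=> hx hy; have /orP [h|h] := vle_total x y.
  by apply: vlt_le_trans hx _; rewrite vle_D ?vle_refl.
by apply: vlt_le_trans hy _; rewrite vle_D ?vle_refl.
Qed.
Lemma vle_Nl u x : vle (- u) x = vle u x.
Proof.
apply/vleP/vleP => [[c cO ->]|[c cO ->]]; exists (- c); rewrite ?O_N //; ring.
Qed.
Lemma vlt_N u x : vlt u (- x) = vlt u x.
Proof. by rewrite /vlt vle_Nl. Qed.
Lemma vlt_sum I (r : seq I) (P : pred I) (F : I -> K) u : u != 0 ->
  (forall i, P i -> vlt u (F i)) -> vlt u (\sum_(i <- r | P i) F i).
Proof.
move=> u0 h; apply: (big_ind (fun x => vlt u x)) => //.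
- exact: vlt_0.
- exact: vlt_D.
Qed.
Lemma vlt_mul2l c a b : c != 0 -> vlt (c * a) (c * b) = vlt a b.
Proof. by move=> c0; rewrite /vlt vle_mul2l. Qed.

Lemma inM_vlt x : inM x = vlt 1 x.
Proof.
rewrite /vlt /Defs.inM /Defs.vle oner_eq0 mul1r.
have [->|x0] := eqVneq x 0; first by rewrite O_0.
by have := O_V x0; case: (x \in O); case: (x^-1 \in O).
Qed.
Lemma inM_O x : inM x -> x \in O. Proof. by case/andP. Qed.
Lemma inM_Ml c x : c \in O -> inM x -> inM (c * x).
Proof. by rewrite !inM_vlt => cO h; apply: vlt_le_trans h _; rewrite vle_Ml. Qed.
Lemma inM_sum I (r : seq I) (P : pred I) (F : I -> K) :
  (forall i, P i -> inM (F i)) -> inM (\sum_(i <- r | P i) F i).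
Proof.
move=> h; rewrite inM_vlt; apply: vlt_sum; rewrite ?oner_neq0 // => i /h.
by rewrite inM_vlt.
Qed.
Lemma vlt_div u w : u != 0 -> inM (w / u) = vlt u w.
Proof.
by move=> u0; rewrite inM_vlt -(vlt_mul2l _ _ u0) mulr1 mulrC divfK.
Qed.
Lemma unitO_1D x : inM x -> unitO O (1 + x).
Proof.
move=> hx; rewrite /unitO.
have h : vle (1 + x) 1.
  apply/negPn; apply/negP => h; have : vlt 1 1 by
    rewrite -[X in vlt _ X](addrK x) vlt_D // vlt_N -inM_vlt.
  by rewrite (negPf (vlt_irr 1)).
have x0 : 1 + x != 0 by apply: contraTneq h => ->; rewrite vle_0l oner_eq0.
rewrite x0 (O_D O_1 (inM_O hx)) /=.
by move: h; rewrite /Defs.vle (negPf x0) div1r.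
Qed.

Lemma nderivn_nderivn (p : {poly K}) i j :
  (p^`N(j))^`N(i) = p^`N(i + j) *+ 'C(i + j, j).
Proof.
apply/polyP => l; rewrite !coefE -!mulrnA.
have -> : (j + (i + l) = i + j + l)%N by lia.
congr (_ *+ _); rewrite mulnC; apply/eqP.
(* Multiplied by $i!\,j!\,l!$, both products of binomial coefficients become $(i+j+l)!$. *)
have h0 : (0 < i`! * j`! * l`!)%N by rewrite !muln_gt0 !fact_gt0.
rewrite -(eqn_pmul2r h0); apply/eqP.
have f a b : ('C(a + b, a) * (a`! * b`!) = (a + b)`!)%N.
  by rewrite -(bin_fact (leq_addr b a)) addKn.
have e1 := f j (i + l)%N; have e2 := f i l; have e3 := f (i + j)%N l.
have e4 := f j i; rewrite [(j + i)%N]addnC in e4.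
have e5 : (j + (i + l) = i + j + l)%N by lia.
rewrite e5 in e1.
transitivity ((i + j + l)`!); first by rewrite -e1 -e2; ring.
by rewrite -e3 -e4; ring.
Qed.

Lemma nderivn_horner_widen (p : {poly K}) n x h : (size p <= n)%N ->
  p.[x + h] = \sum_(i < n) p^`N(i).[x] * h ^+ i.
Proof. by move=> hn; apply: nderiv_taylor_wide => //; exact: mulrC. Qed.

(* Recentring from [b] to [b'] and rescaling from [t] to [z], both no larger
   than [t], cannot decrease the order of the Taylor terms. *)
Lemma taylor_shift (p : {poly K}) (u a b b' t z : K) j :
  (forall i, (j <= i)%N -> vle u (a * (p^`N(i).[b] * t ^+ i))) ->
  vle t (b' - b) -> vle t z -> vle u (a * (p^`N(j).[b'] * z ^+ j)).
Proof.
move=> h hb hz; rewrite -[b'](subrK b) addrC.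
rewrite (nderivn_horner_widen b (b' - b) (leqnn (size (p^`N(j))))).
rewrite mulr_suml mulr_sumr; apply: vle_sum => i _.
rewrite nderivn_nderivn hornerMn -[_ *+ 'C(_, _)]mulr_natl.
have -> : a * ('C(i + j, j)%:R * p^`N(i + j).[b] * (b' - b) ^+ i * z ^+ j) =
  'C(i + j, j)%:R * (a * p^`N(i + j).[b]) * ((b' - b) ^+ i * z ^+ j) by ring.
apply: (vle_trans (h (i + j)%N (leq_addl _ _))).
rewrite exprD [a * (_ * (_ * _))]mulrA; apply: vle_mul; first by apply: vle_Ml; exact: O_nat.
by apply: vle_mul; exact: vle_exp.
Qed.

(** * Newton's method at a general scale *)

Section Newton.
Hypothesis hens : henselian O.
Variables (p : {poly K}) (y z u : K).
Hypothesis hu : forall i, (1 <= i)%N -> vle u (p^`N(i).[y] * z ^+ i).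
Let D := p^`().[y] * z.
Hypothesis D0 : D != 0.
Hypothesis hlt : vlt (D * D) (p.[y] * u).
Let w := p.[y] / p^`().[y].

Let z0 : z != 0. Proof. by move: D0; rewrite mulf_eq0 negb_or => /andP []. Qed.
Let py0 : p^`().[y] != 0.
Proof. by move: D0; rewrite mulf_eq0 negb_or => /andP []. Qed.
Let uD : vle u D.
Proof. by have := hu (leqnn 1); rewrite nderivn1 expr1. Qed.
Let u0 : u != 0.
Proof. by apply: contraTneq uD => ->; rewrite vle_0l D0. Qed.
Let Epu : inM (p.[y] * u / (D * D)).
Proof. by rewrite vlt_div // mulf_neq0. Qed.
Let EpD : inM (p.[y] / D).
Proof.
have -> : p.[y] / D = D / u * (p.[y] * u / (D * D)).
  by field; rewrite u0 /= D0.
apply: inM_Ml => //.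
by move: uD; rewrite /Defs.vle (negPf u0).
Qed.

(** Writing the $i$-th coefficient as $cu/z^i$ and $w=(p(y)/D)z$ turns the quotient into
    $c\,(p(y)/D)^{i-2}\cdot p(y)u/D^2$. The last factor lies in the maximal ideal by [hlt], the
    others in the valuation ring. *)
Lemma newton_term i : (2 <= i)%N -> p.[y] != 0 ->
  inM (p^`N(i).[y] * w ^+ i / p.[y]).
Proof.
case: i => [|[|i]] // _ p0.
have /vleP [c cO e] := hu (ltn0Sn i.+1).
have -> : p^`N(i.+2).[y] = c * u / z ^+ i.+2.
  by rewrite -e mulfK // expf_neq0.
have -> : c * u / z ^+ i.+2 * w ^+ i.+2 / p.[y] =
    (c * (p.[y] / D) ^+ i) * (p.[y] * u / (D * D)).
  have -> : w = p.[y] / D * z by rewrite /w /D; field; rewrite z0.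
  rewrite exprMn; have : z ^+ i.+2 != 0 by rewrite expf_neq0.
  move: (z ^+ i.+2) => Z Z0.
  rewrite [(_ / D) ^+ i.+2]exprS [(_ / D) ^+ i.+1]exprS.
  by move: ((p.[y] / D) ^+ i) => W; field; rewrite ?p0 ?D0 ?Z0.
by apply: inM_Ml => //; apply: O_M => //; apply: O_X; exact: inM_O.
Qed.

(** Makes the root found by Newton's method a centre without any loss: [taylor_shift] carries this
    bound from [y] to the root. *)
Lemma newton_vle i : vle p.[y] (p^`N(i).[y] * w ^+ i).
Proof.
case: i => [|[|i]]; first by rewrite nderivn0 expr0 mulr1 vle_refl.
  by rewrite nderivn1 expr1 /w mulrC divfK // vle_refl.
have [p0|p0] := eqVneq p.[y] 0.
  by rewrite /w p0 mul0r expr0n mulr0 vle_0.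
have := inM_O (newton_term (isT : (2 <= i.+2)%N) p0).
by rewrite /Defs.vle (negPf p0).
Qed.

(** Divided by $p(y)$, the polynomial $p(y+ws)$ in $s$ is congruent to $1+s$ modulo the maximal
    ideal, so the Henselian property applies at $s=-1$. *)
Lemma newton_root : exists2 s, s \in O & root p (y + w * s).
Proof.
have [p0|p0] := eqVneq p.[y] 0.
  by exists 0; rewrite ?O_0 // mulr0 addr0 /root p0.
(* Two extra places, so that the coefficients of degree 0 and 1 can be split off whatever the size
   of [p]. *)
pose n := (size p).+2.
pose g i := p^`N(i).[y] * w ^+ i / p.[y].
pose G := \poly_(i < n) g i.
have g0 : g 0 = 1 by rewrite /g nderivn0 expr0 mulr1 divff.
have g1 : g 1 = 1 by rewrite /g nderivn1 expr1 /w; field; rewrite ?p0 ?py0.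
have gM i : (2 <= i)%N -> inM (g i) by move=> h; apply: newton_term.
have Gs s : G.[s] * p.[y] = p.[y + w * s].
  rewrite (@nderivn_horner_widen _ n) ?leqW // horner_poly mulr_suml.
  by apply: eq_bigr => i _; rewrite exprMn /g; field.
have GO i : G`_i \in O.
  rewrite coef_poly; case: ifP => _; last exact: O_0.
  by case: i => [|[|i]]; rewrite ?g0 ?g1 ?O_1 //; apply: inM_O; exact: gM.
have OX i : (-1) ^+ i \in O by rewrite O_X ?O_N ?O_1.
have [||s sO [rs _]] := hens GO (O_N O_1).
- rewrite horner_poly 2!big_ord_recl /= g0 g1 expr0 expr1 !mulr1 /= addrA.
  rewrite mul1r subrr add0r; apply: inM_sum => i _.
  by rewrite mulrC inM_Ml ?gM.
- have -> : G^`().[-1] = 1 + \sum_(i < size p) (-1) ^+ i.+1 * (g i.+2 *+ i.+2).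
    rewrite (@horner_coef_wide _ n.-1); last first.
      apply/leq_sizeP => j hj; rewrite coef_deriv coef_poly ltnNge.
      by rewrite (_ : (n <= j.+1)%N) // mul0rn.
    rewrite /n /= big_ord_recl /= coef_deriv coef_poly /= g1 expr0 mulr1.
    congr (_ + _); apply: eq_bigr => i _.
    by rewrite coef_deriv coef_poly /= /bump /= !add1n !ltnS (ltn_ord i) mulrC.
  apply: unitO_1D; apply: inM_sum => i _.
  by rewrite -mulr_natl mulrA inM_Ml ?gM ?O_M ?O_nat.
by exists s => //; rewrite /root -Gs; move: rs; rewrite /root => /eqP ->; rewrite mul0r.
Qed.
End Newton.

End Valuation.

(** * Centres of polynomials *)

Section Centres.
Variables (K : fieldType) (O : {pred K}).
Hypothesis VR : valuation_ring O.
Hypothesis hens : henselian O.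
Hypothesis ch0 : char0 K.
Local Notation vle := (vle O).
Local Notation vlt := (vlt O).
Local Notation inM := (inM O).

Lemma natr_neq0 n : (0 < n)%N -> n%:R != 0 :> K.
Proof. by move=> n0; rewrite ((pcharf0P K).1 ch0) -lt0n. Qed.

Lemma vle_nat n x : vle x (n%:R * x).
Proof. by apply: vle_Ml => //; exact: O_nat. Qed.

Lemma vle_natdvd m n x : (m %| n)%N -> vle (m%:R * x) (n%:R * x).
Proof. by case/dvdnP => k ->; rewrite natrM -mulrA vle_nat. Qed.

(* The value at [y] cancels at most [N] from the least Taylor term at [b]. *)
Definition nocoll (N : nat) (p : {poly K}) (b y : K) :=
  forall j, vle p.[y] (N%:R * (p^`N(j).[b] * (y - b) ^+ j)).

Lemma nocoll_closer N p b b' y :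
  vle (y - b) (y - b') -> nocoll N p b y -> nocoll N p b' y.
Proof.
move=> h nc j; apply: (taylor_shift VR _ (t := y - b)) => //.
have -> : b' - b = (y - b) - (y - b') by ring.
by apply: vle_B => //; exact: vle_refl.
Qed.

Lemma nderiv_deriv (p : {poly K}) i : (p^`())^`N(i) = p^`N(i.+1) *+ i.+1.
Proof. by rewrite -nderivn1 nderivn_nderivn addn1 bin1. Qed.

Lemma nderivn_neq0 (p : {poly K}) k : (p^`())^`N(k) != 0 -> p^`N(k.+1) != 0.
Proof. by apply: contraNneq; rewrite nderiv_deriv => ->; rewrite mul0rn. Qed.

Lemma root_nderiv_deriv (p : {poly K}) k b :
  root (p^`())^`N(k) b -> root p^`N(k.+1) b.
Proof.
rewrite nderiv_deriv /root hornerMn -mulr_natl mulf_eq0.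
by rewrite (negPf (natr_neq0 _)).
Qed.

Definition centre (p : {poly K}) (b : K) :=
  b = 0 \/ exists k, p^`N(k) != 0 /\ root p^`N(k) b.

(** The factorial clears the factors $j+1$ between Taylor coefficients of $p'$ and of $p$. The
    square is what a failure must exceed: the linear term loses at most $N$, so a loss beyond $N^2$
    puts $p(y)$ beyond $N$ times the linear term, as Newton's method requires. *)
Fixpoint cbound (n : nat) : nat :=
  if n is n'.+1 then (cbound n' * (n'.+1)`!) ^ 2 else 1.

Lemma cbound_gt0 n : (0 < cbound n)%N.
Proof. by elim: n => //= n IH; rewrite expn_gt0 muln_gt0 IH fact_gt0. Qed.

(** A constant term of strictly least order cannot be cancelled by the others, so cancellation
    involves a term of positive degree. Only such terms are controlled through $p'$. *)
Lemma taylor_lt_pos (p : {poly K}) b y j :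
  vlt (p^`N(j).[b] * (y - b) ^+ j) p.[y] ->
  exists2 i, (1 <= i < size p)%N &
    vle (p^`N(i).[b] * (y - b) ^+ i) (p^`N(j).[b] * (y - b) ^+ j).
Proof.
case: j => [|j] hj.
  rewrite nderivn0 expr0 mulr1 in hj *.
  apply: NNPP => hn.
  have h i : (1 <= i < size p)%N -> vlt p.[b] (p^`N(i).[b] * (y - b) ^+ i).
    by move=> hi; apply/negP => h; apply: hn; exists i.
  have e : p.[y] = p.[b] + \sum_(1 <= i < size p) p^`N(i).[b] * (y - b) ^+ i.
    have [->|p0] := eqVneq p 0.
      by rewrite !horner0 size_poly0 big_geq // addr0.
    rewrite -{1}[y](subrK b) addrC.
    rewrite (nderivn_horner_widen b (y - b) (leqnn (size p))).
    rewrite -(big_mkord predT (fun i => p^`N(i).[b] * (y - b) ^+ i)).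
    by rewrite big_ltn ?size_poly_gt0 // nderivn0 expr0 mulr1.
  have : vlt p.[b] p.[b].
    rewrite -{2}[p.[b]](addrK (\sum_(1 <= i < size p) p^`N(i).[b] * (y - b) ^+ i)).
    rewrite -e; apply: vlt_D => //; rewrite vlt_N //.
    rewrite big_nat; apply: vlt_sum => //; exact: vlt_neq0 hj.
  by rewrite (negPf (vlt_irr VR _)).
exists j.+1; last exact: vle_refl.
rewrite /= ltnNge; apply/negP => h; move: (vlt_neq0 VR hj).
by rewrite (nderivn_poly0 h) horner0 mul0r eqxx.
Qed.

Lemma centre_exists n (p : {poly K}) y : (size p <= n)%N ->
  exists2 b, centre p b & nocoll (cbound n) p b y.
Proof.
elim: n p => [|n IH] p hp.
  exists 0; first by left.
  move: hp; rewrite leqn0 size_poly_eq0 => /eqP -> j.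
  by rewrite nderivn_poly0 ?size_poly0 // !horner0 mul0r mulr0 vle_0.
have [|b cb nb] := IH p^`().
  have [->|p0] := eqVneq p 0; first by rewrite deriv0 size_poly0.
  by rewrite -ltnS (leq_trans (lt_size_deriv p0)).
have cb' : centre p b.
  case: cb => [->|[k [hk rk]]]; first by left.
  by right; exists k.+1; split; [exact: nderivn_neq0|exact: root_nderiv_deriv].
set N := (cbound n * (n.+1)`!)%N.
have N0 : (0 < N)%N by rewrite muln_gt0 cbound_gt0 fact_gt0.
have NK : N%:R != 0 :> K by exact: natr_neq0.
set z := y - b.
have yE : y = b + z by rewrite /z addrC subrK.
pose c j := p^`N(j).[b] * z ^+ j.
have hD j : (1 <= j < size p)%N -> vle (p^`().[y] * z) (N%:R * c j).
  case: j => // j /andP [_ hj].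
  have e : N%:R * c j.+1 =
      ((n.+1)`! %/ j.+1)%:R * (((cbound n)%:R * ((p^`())^`N(j).[b] * z ^+ j)) * z).
    have hd : (j.+1 %| (n.+1)`!)%N.
      by apply: dvdn_fact; rewrite (leq_trans (ltnW hj)) //=.
    rewrite /c nderiv_deriv hornerMn -[_ *+ j.+1]mulr_natl exprSr /N -{1}(divnK hd).
    by rewrite !natrM; ring.
  rewrite e; apply: (vle_trans VR) (vle_nat _ _).
  by apply: vle_mul => //; exact: vle_refl.
have [nc|/not_all_ex_not [j0 /negP hj0]] := classic (nocoll (N ^ 2) p b y).
  by exists b.
have {hj0} hj0 : vlt ((N ^ 2)%:R * c j0) p.[y] by [].
have [|i hi hi0] := @taylor_lt_pos p b y j0.
  exact: vle_lt_trans (vle_nat _ _) hj0.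
have lt1 : vlt (N%:R * (p^`().[y] * z)) p.[y].
  apply: vle_lt_trans hj0 => //.
  rewrite -mulnn natrM -mulrA; apply: vle_mul => //; first exact: vle_refl.
  apply: (vle_trans VR (hD i hi)).
  by apply: vle_mul => //; exact: vle_refl.
have D0 : p^`().[y] * z != 0.
  by have := vlt_neq0 VR lt1; rewrite mulf_eq0 negb_or => /andP [].
(* By [hD] no Taylor term of positive degree has order below that of [u]; this is the bound on which
   Newton's method relies. *)
pose u := p^`().[y] * z / N%:R.
have Eu : p^`().[y] * z = N%:R * u by rewrite /u [RHS]mulrC divfK.
have hu i' : (1 <= i')%N -> vle u (p^`N(i').[y] * z ^+ i').
  move=> i1; rewrite -[_ * _]mul1r.
  apply: (taylor_shift VR _ (b := b) (t := z)); rewrite ?vle_refl //.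
  move=> l hl; rewrite mul1r; case: (ltnP l (size p)) => hs; last first.
    by rewrite (nderivn_poly0 hs) horner0 mul0r vle_0.
  by rewrite -(vle_mul2l VR _ _ NK) -Eu hD // hs (leq_trans i1 hl).
have hlt : vlt (p^`().[y] * z * (p^`().[y] * z)) (p.[y] * u).
  have -> : p^`().[y] * z * (p^`().[y] * z) = u * (N%:R * (p^`().[y] * z)).
    by rewrite {1}Eu; ring.
  rewrite [p.[y] * u]mulrC vlt_mul2l // mulf_neq0 ?invr_eq0 //.
have [s sO rs] := newton_root VR hens hu D0 hlt.
have nw := newton_vle VR hu D0 hlt.
set w := p.[y] / p^`().[y] in rs nw.
exists (y + w * s).
  right; exists 0; rewrite nderivn0; split=> //.
  by apply: contraTneq lt1 => ->; rewrite vltNge horner0 deriv0 horner0 mul0r mulr0 vle_0.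
move=> j; apply: (vle_trans VR) (vle_nat _ _); rewrite -[_ * _]mul1r.
have hw : vle w (w * s) by rewrite mulrC vle_Ml.
apply: (taylor_shift VR _ (b := y) (t := w)).
- by move=> i' _; rewrite mul1r.
- by rewrite addrC addKr.
- have -> : y - (y + w * s) = - (w * s) by ring.
  by rewrite vle_N.
Qed.

Lemma common_centre n k (p : nat -> {poly K}) y :
  (forall i, (i < k)%N -> size (p i) <= n)%N ->
  exists2 b, b = 0 \/ (exists i, (i < k)%N /\
                       exists j, (p i)^`N(j) != 0 /\ root (p i)^`N(j) b) &
    forall i, (i < k)%N -> nocoll (cbound n) (p i) b y.
Proof.
elim: k => [|k IH] hp; first by exists 0; [left|].
have [i hi|b1 c1 n1] := IH; first by apply: hp; exact: ltnW.
have [b2 c2 n2] := centre_exists y (hp k (ltnSn k)).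
have /orP [h|h] := vle_total VR (y - b1) (y - b2).
- exists b2.
    by case: c2 => [->|h2]; [left|right; exists k].
  move=> i; rewrite ltnS leq_eqVlt => /orP [/eqP ->//|hi].
  exact: nocoll_closer h (n1 i hi).
- exists b1.
    case: c1 => [->|[i [hi h2]]]; [by left|right; exists i; split=> //].
    exact: ltnW.
  move=> i; rewrite ltnS leq_eqVlt => /orP [/eqP ->|/n1//].
  exact: nocoll_closer h n2.
Qed.

(** Division-free form of equality in RV. The strict inequality rules out $x=0$, so the pair of
    zeros is a case of its own. *)
Lemma rv_eqP n x y : rv_eq O n x y <->
  (x = 0 /\ y = 0) \/ vlt (n.+1%:R * x) (y - x).
Proof.
have N0 : n.+1%:R != 0 :> K by exact: natr_neq0.
have E : x != 0 -> inM ((y / x - 1) / n.+1%:R) = vlt (n.+1%:R * x) (y - x).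
  move=> x0; rewrite -(@vlt_div _ _ VR (n.+1%:R * x)) ?mulf_neq0 //.
  by congr (Defs.inM O _); move: (n.+1%:R) N0 => N N0; field; rewrite x0.
split=> [[h1 h2]|[[-> ->]|h]].
- have [x0|x0] := eqVneq x 0; last by right; rewrite -E // h2.
  by left; split=> //; apply/eqP; rewrite -h1 x0.
- by split; rewrite ?eqxx.
have x0 : x != 0.
  by have := vlt_neq0 VR h; rewrite mulf_eq0 negb_or => /andP [].
split; last by rewrite E.
rewrite (negPf x0); apply/esym/negbTE; apply: contraTneq h => ->.
by rewrite vltNge negbK sub0r vle_Nl // vle_nat.
Qed.

Lemma vlt_near u x : vlt u (x - u) -> vle u x /\ vle x u.
Proof.
move=> h; have e : x = (x - u) + u by ring.
split; first by rewrite e; apply: vle_D => //; [exact: vltW|exact: vle_refl].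
apply/negPn/negP => h'; have : vlt u u.
  have e2 : u = x - (x - u) by ring.
  by rewrite {2}e2; apply: vlt_D => //; rewrite vlt_N.
by rewrite (negPf (vlt_irr VR _)).
Qed.

Lemma rv_eq_near n x y : rv_eq O n x y -> vle x y /\ vle y x.
Proof.
move/rv_eqP => [[-> ->]|h]; first by rewrite vle_refl.
by apply: vlt_near; apply: vle_lt_trans (vle_nat _ _) h.
Qed.

Lemma rv_eq_refl n x : rv_eq O n x x.
Proof.
apply/rv_eqP; have [->|x0] := eqVneq x 0; first by left.
by right; rewrite subrr vlt_0 // mulf_neq0 ?natr_neq0.
Qed.

Lemma rv_eq_sym n x y : rv_eq O n x y -> rv_eq O n y x.
Proof.
move=> h; have [h1 h2] := rv_eq_near h; move: h => /rv_eqP [[-> ->]|h].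
  exact: rv_eq_refl.
apply/rv_eqP; right; have -> : x - y = - (y - x) by ring.
rewrite vlt_N //; apply: vle_lt_trans h => //.
by apply: vle_mul => //; exact: vle_refl.
Qed.

Lemma rv_eq_trans n y x z : rv_eq O n x y -> rv_eq O n y z -> rv_eq O n x z.
Proof.
move=> h; have [h1 h2] := rv_eq_near h; move: h => /rv_eqP [[-> ->]|h] // h'.
apply/rv_eqP; right; have -> : z - x = (z - y) + (y - x) by ring.
apply: vlt_D => //; have x0 := vlt_neq0 VR h.
move: h' => /rv_eqP [[y0 z0]|h'].
  by rewrite y0 z0 subrr vlt_0.
by apply: vle_lt_trans h' => //; apply: vle_mul => //; exact: vle_refl.
Qed.

Lemma rv_eq_dvd n m x y : (n.+1 %| m.+1)%N -> rv_eq O m x y -> rv_eq O n x y.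
Proof.
move=> d /rv_eqP [[-> ->]|h]; first exact: rv_eq_refl.
by apply/rv_eqP; right; apply: vle_lt_trans h => //; exact: vle_natdvd.
Qed.

Lemma rv_eq_0 n x : rv_eq O n x 0 <-> x = 0.
Proof.
split=> [h|->]; last exact: rv_eq_refl.
by have [_] := rv_eq_near h; rewrite vle_0l // => /eqP.
Qed.

Lemma rv_eq_mul n x x' y y' :
  rv_eq O n x x' -> rv_eq O n y y' -> rv_eq O n (x * y) (x' * y').
Proof.
have main a b b' : rv_eq O n b b' -> rv_eq O n (a * b) (a * b').
  have [->|a0] := eqVneq a 0; first by rewrite !mul0r => _; exact: rv_eq_refl.
  move=> /rv_eqP [[-> ->]|h]; first by rewrite mulr0; exact: rv_eq_refl.
  by apply/rv_eqP; right; rewrite mulrCA -mulrBr vlt_mul2l.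
move=> hx hy; apply: (rv_eq_trans (main _ _ _ hy)).
by rewrite ![_ * y']mulrC; exact: main.
Qed.

Lemma rv_eq_mulI n a x y : a != 0 -> rv_eq O n (x * a) (y * a) -> rv_eq O n x y.
Proof.
move=> a0 h; have := rv_eq_mul h (rv_eq_refl n a^-1).
by rewrite !mulfK.
Qed.

Lemma rv_eq_exp n x y k : rv_eq O n x y -> rv_eq O n (x ^+ k) (y ^+ k).
Proof.
move=> h; elim: k => [|k IH]; first exact: rv_eq_refl.
by rewrite !exprS; exact: rv_eq_mul.
Qed.

Lemma rv_eq_vlt_sub n x y E : E != 0 -> vle E (n.+1%:R * x) ->
  rv_eq O n x y -> vlt E (y - x).
Proof.
move=> E0 h /rv_eqP [[-> ->]|h']; first by rewrite subrr vlt_0.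
exact: vle_lt_trans h h'.
Qed.

(** Identifies the sum in the first condition of $P_{N,d}$: for Taylor coefficients $a_i$ of $q$ at
    $b$ it is represented by $q'(b+z)$. *)
Lemma horner_deriv_taylor (q : {poly K}) d b z : (size q <= d.+1)%N ->
  q^`().[b + z] = \sum_(1 <= i < d.+1) i%:R * q^`N(i).[b] * z ^+ i.-1.
Proof.
move=> hq; rewrite (@nderivn_horner_widen _ _ d); last first.
  have [->|q0] := eqVneq q 0; first by rewrite deriv0 size_poly0.
  by rewrite -ltnS (leq_trans (lt_size_deriv q0)).
rewrite big_add1 /= big_mkord; apply: eq_bigr => i _.
by rewrite nderiv_deriv hornerMn mulr_natl.
Qed.

(** The exact Taylor terms sum to $q(b+z)=0$, which gives the second condition. In the first, the
    loss at the centre of $q'$ costs [C] and the factors $i\le d$ cost at most $d!$; both are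
    absorbed by $N$. *)
Lemma Pcond_of_root n d C (q : {poly K}) b z :
  (size q <= d.+1)%N -> q.[b + z] = 0 ->
  nocoll C q^`() b (b + z) -> (C * d`! %| n.+1)%N ->
  let a i := q^`N(i).[b] in Pcond1 O n d z a /\ Pcond2 O n d z a.
Proof.
move=> hq q0 nc hC a; split; last first.
  exists z; split; first exact: rv_eq_refl.
  exists (fun i => a i * z ^+ i); split; first by move=> *; exact: rv_eq_refl.
  by rewrite big_mkord -nderivn_horner_widen.
pose S := q^`().[b + z].
have h1 i : (1 <= i <= d)%N -> vle S (n.+1%:R * (a i * z ^+ i.-1)).
  case: i => // i /andP [_ hi] /=.
  have := nc i; have -> : b + z - b = z by ring.
  rewrite nderiv_deriv hornerMn => h.
  apply: (vle_trans VR h); rewrite -[_ *+ i.+1]mulr_natl -!mulrA mulrA -natrM.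
  apply: vle_natdvd; apply: dvdn_trans hC; apply: dvdn_mul => //.
  exact: dvdn_fact.
move=> y hy i hi; have [S0|S0] := eqVneq S 0.
  by have := h1 i hi; rewrite S0 vle_0l // => /eqP ->; exact: vle_0.
apply: (vle_trans VR) (h1 i hi); apply: (proj2 (vlt_near _)).
(* Other representatives change the sum only by elements of order greater than that of [S], so its
   order stays the same. *)
have -> : \sum_(1 <= j < d.+1) y j - S =
    \sum_(1 <= j < d.+1) (y j - j%:R * a j * z ^+ j.-1).
  by rewrite /S (horner_deriv_taylor b z hq) sumrB.
rewrite big_nat; apply: vlt_sum => // j; rewrite ltnS => hj.
apply: (@rv_eq_vlt_sub n) => //; last by apply: rv_eq_sym; exact: hy.
rewrite -[_ * a j * _]mulrA mulrCA; apply: (vle_trans VR (h1 j hj)).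
exact: vle_nat.
Qed.

(** [b + xt] is an approximate root: the first condition bounds the loss in the linear term by $N$,
    and the precision $N^2$ of the second puts $q(b+xt)$ beyond $N$ times that term. Newton's method
    then applies, and its correction is too small to change the class in $\mathrm{RV}_N$. *)
Lemma root_of_Pcond n d (q : {poly K}) b x (a : nat -> K) :
  (size q <= d.+1)%N -> x != 0 ->
  (forall i, (i <= d)%N -> rv_eq O (sqi n) (a i) q^`N(i).[b]) ->
  Pcond1 O n d x a -> Pcond2 O n d x a ->
  exists2 z, rv_eq O n x z & q.[b + z] = 0.
Proof.
move=> hq x0 ha P1 [xt [hx [zz [hz sz]]]].
pose c i := q^`N(i).[b].
have sqE : (sqi n).+1 = (n.+1 * n.+1)%N by rewrite /sqi -mulnn.
have dn : (n.+1 %| (sqi n).+1)%N by rewrite sqE dvdn_mulr.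
have N0 : n.+1%:R != 0 :> K by exact: natr_neq0.
have [xt1 xt2] := rv_eq_near hx.
have xt0 : xt != 0 by apply: contraNneq x0 => /= e; move: xt1; rewrite e vle_0l.
pose S := q^`().[b + xt].
have hS i : (1 <= i <= d)%N -> vle (S * xt) (n.+1%:R * (c i * xt ^+ i)).
  move=> hi.
  (* These representatives sum exactly to $q'(b+xt)$. *)
  have h := P1 (fun i => i%:R * c i * xt ^+ i.-1) _ i hi.
  rewrite -(horner_deriv_taylor b xt hq) -/S in h.
  case: i hi h => // i /andP [_ hi] /= h.
  have -> : n.+1%:R * (c i.+1 * xt ^+ i.+1) = n.+1%:R * (c i.+1 * xt ^+ i) * xt.
    by rewrite exprSr; ring.
  apply: vle_mul => //; last exact: vle_refl.
  apply: (vle_trans VR) (h _) _ => [j /andP [_ hj]|].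
    apply: rv_eq_mul (rv_eq_exp _ hx); apply: rv_eq_mul (rv_eq_refl _ _) _.
    by apply: rv_eq_sym; apply: rv_eq_dvd (ha j hj).
  apply: vle_mul => //; first exact: vle_refl.
  apply: vle_mul => //; first exact: (proj1 (rv_eq_near (ha _ hi))).
  exact: vle_exp.
have hzc i : (i <= d)%N -> rv_eq O (sqi n) (zz i) (c i * xt ^+ i).
  move=> hi; apply: rv_eq_trans (hz i hi) _.
  by apply: rv_eq_mul (rv_eq_refl _ _); exact: ha.
(* The first condition bounds terms of positive degree only; the vanishing sum passes the bound on
   to degree 0. *)
have z0E : zz 0 = - \sum_(1 <= i < d.+1) zz i.
  by move: sz; rewrite big_ltn // => /eqP; rewrite addr_eq0 => /eqP.
have hSz i : (i <= d)%N -> vle (S * xt) (n.+1%:R * zz i).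
  have h j : (1 <= j <= d)%N -> vle (S * xt) (n.+1%:R * zz j).
    move=> hj; apply: (vle_trans VR (hS j hj)); apply: vle_mul => //.
      exact: vle_refl.
    by case/andP: hj => _ /hzc /rv_eq_near [].
  case: i => [_|i hi]; last by apply: h.
  by rewrite z0E mulrN vle_N // mulr_sumr big_nat; apply: vle_sum.
(* As the [zz i] sum to 0, only the discrepancies between the Taylor terms and their representatives
   remain. *)
have qE : q.[b + xt] = \sum_(0 <= i < d.+1) (c i * xt ^+ i - zz i).
  by rewrite (nderivn_horner_widen b xt hq) sumrB sz subr0 big_mkord.
have [S0|S0] := eqVneq (S * xt) 0.
  exists xt; first exact: rv_eq_sym.
  rewrite qE big_nat big1 // => i; rewrite ltnS => hi.
  have := hSz i hi; rewrite S0 vle_0l // mulf_eq0 (negPf N0) /= => /eqP zi.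
  have := hzc i hi; rewrite zi => /rv_eq_sym /rv_eq_0 ->; by rewrite subrr.
have lt1 : vlt (n.+1%:R * (S * xt)) q.[b + xt].
  rewrite qE big_nat; apply: vlt_sum => // [|i]; first by rewrite mulf_neq0.
  rewrite ltnS => hi; apply: (@rv_eq_vlt_sub (sqi n)); first by rewrite mulf_neq0.
    rewrite sqE natrM -mulrA vle_mul2l //; exact: hSz.
  exact: hzc.
pose u := S * xt / n.+1%:R.
have Eu : S * xt = n.+1%:R * u by rewrite /u [RHS]mulrC divfK.
have hu i : (1 <= i)%N -> vle u (q^`N(i).[b + xt] * xt ^+ i).
  move=> i1; rewrite -[_ * _]mul1r.
  apply: (taylor_shift VR _ (b := b) (t := xt)); rewrite ?vle_refl //; last first.
    by rewrite addrC addKr vle_refl.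
  move=> l hl; rewrite mul1r; case: (leqP l d) => hs; last first.
    by rewrite (nderivn_poly0 (leq_trans hq hs)) horner0 mul0r vle_0.
  by rewrite -(vle_mul2l VR _ _ N0) -Eu hS // hs (leq_trans i1 hl).
have hlt : vlt (S * xt * (S * xt)) (q.[b + xt] * u).
  have -> : S * xt * (S * xt) = u * (n.+1%:R * (S * xt)) by rewrite {1}Eu; ring.
  rewrite [_ * u]mulrC vlt_mul2l // mulf_neq0 ?invr_eq0 //.
have [s sO rs] := newton_root VR hens hu S0 hlt.
exists (xt + q.[b + xt] / S * s); last by apply/eqP; rewrite addrA.
apply: (rv_eq_trans (rv_eq_sym hx)); apply/rv_eqP; right.
rewrite addrC addKr.
have S1 : S != 0 by move: S0; rewrite mulf_eq0 negb_or => /andP [].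
rewrite -(vlt_mul2l VR _ _ S1).
have -> : S * (q.[b + xt] / S * s) = s * q.[b + xt] by field.
rewrite mulrCA; apply: (vlt_le_trans VR lt1); exact: vle_Ml.
Qed.

End Centres.

(** * Existential definability over RV *)

Scheme term_mut := Induction for term Sort Prop
  with targs_mut := Induction for targs Sort Prop.
Combined Scheme term_targs_ind from term_mut, targs_mut.

Section Substitution.
Variable E : expansion.

Section Sub.
Variable sg : forall s, nat -> term E s.

Fixpoint sub_term s (t : term E s) : term E s :=
  match t in term _ s0 return term E s0 with
  | tvar s0 k => sg s0 k
  | tapp f ts => tapp f (sub_targs ts)
  end
with sub_targs ss (ts : targs E ss) : targs E ss :=
  match ts in targs _ ss0 return targs E ss0 with
  | tnil => tnil
  | tcons _ _ t ts' => tcons (sub_term t) (sub_targs ts')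
  end.

(* Meant for quantifier-free formulas only: quantified subformulas are left
   untouched. *)
Fixpoint sub_form (p : formula E) : formula E :=
  match p with
  | Feq s t u => Feq (sub_term t) (sub_term u)
  | Frel r ts => @Frel E r (sub_targs ts)
  | Fnot q => Fnot (sub_form q)
  | Fand q r => Fand (sub_form q) (sub_form r)
  | For q r => For (sub_form q) (sub_form r)
  | q => q
  end.

Definition sub_val (M : structure E) (v : assignment M) : assignment M :=
  fun s k => eval_term v (sg s k).

Lemma eval_sub M (v : assignment M) :
  (forall s t, eval_term v (@sub_term s t) = eval_term (sub_val v) t) /\
  (forall ss ts, eval_targs v (@sub_targs ss ts) = eval_targs (sub_val v) ts).
Proof.
apply: term_targs_ind => //= [f ts ->//|s ss t -> ts ->//].
Qed.

Lemma sat_sub M (v : assignment M) p : qf p ->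
  (sat v (sub_form p) <-> sat (sub_val v) p).
Proof.
elim: p => //= [s t u _|r ts _|p IH /IH h|p IHp q IHq /andP [/IHp hp /IHq hq]|
  p IHp q IHq /andP [/IHp hp /IHq hq]].
- by rewrite !(proj1 (eval_sub v)).
- by rewrite (proj2 (eval_sub v)).
- tauto.
- tauto.
- tauto.
Qed.

Lemma qf_sub p : qf (sub_form p) = qf p.
Proof. by elim: p => //= p -> q ->. Qed.
End Sub.

(** VF-variables are not tracked, since the formulas produced by the elimination bind RV-variables
    only. *)
Lemma supp_term_ex :
  (forall s (t : term E s), exists L : seq (nat * nat),
    forall M (v w : assignment M), (forall k, w VF k = v VF k) ->
     (forall n k, (n, k) \in L -> w (RV n) k = v (RV n) k) ->
     eval_term w t = eval_term v t) /\
  (forall ss (ts : targs E ss), exists L : seq (nat * nat),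
    forall M (v w : assignment M), (forall k, w VF k = v VF k) ->
     (forall n k, (n, k) \in L -> w (RV n) k = v (RV n) k) ->
     eval_targs w ts = eval_targs v ts).
Proof.
apply: term_targs_ind => /=.
- move=> [|n] k; first by exists [::] => M v w h _.
  by exists [:: (n, k)] => M v w _; apply; rewrite inE.
- by move=> f ts [L h]; exists L => M v w h1 h2; rewrite (h M v w).
- by exists [::].
- move=> s ss t [L1 h1] ts [L2 h2]; exists (L1 ++ L2) => M v w hv hL.
  rewrite (h1 M v w) // ?(h2 M v w) // => n k hk;
    by apply: hL; rewrite mem_cat hk ?orbT.
Qed.

Lemma supp_form_ex (p : formula E) : qf p -> exists L : seq (nat * nat),
  forall M (v w : assignment M), (forall k, w VF k = v VF k) ->
   (forall n k, (n, k) \in L -> w (RV n) k = v (RV n) k) ->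
   (sat w p <-> sat v p).
Proof.
elim: p => //= [_|_|s t u _|r ts _|p IH /IH [L h]|
  p IHp q IHq /andP [/IHp [L1 h1] /IHq [L2 h2]]|
  p IHp q IHq /andP [/IHp [L1 h1] /IHq [L2 h2]]].
- by exists [::].
- by exists [::].
- have [L1 h1] := proj1 supp_term_ex s t; have [L2 h2] := proj1 supp_term_ex s u.
  exists (L1 ++ L2) => M v w hv hL.
  rewrite (h1 M v w) // ?(h2 M v w) // => n k hk;
    by apply: hL; rewrite mem_cat hk ?orbT.
- have [L h] := proj2 supp_term_ex _ ts.
  by exists L => M v w hv hL; rewrite (h M v w).
- by exists L => M v w hv hL; have := h M v w hv hL; tauto.
- exists (L1 ++ L2) => M v w hv hL.
  have h1' : sat w p <-> sat v p.
    by apply: h1 => // n k hk; apply: hL; rewrite mem_cat hk.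
  have h2' : sat w q <-> sat v q.
    by apply: h2 => // n k hk; apply: hL; rewrite mem_cat hk orbT.
  by tauto.
- exists (L1 ++ L2) => M v w hv hL.
  have h1' : sat w p <-> sat v p.
    by apply: h1 => // n k hk; apply: hL; rewrite mem_cat hk.
  have h2' : sat w q <-> sat v q.
    by apply: h2 => // n k hk; apply: hL; rewrite mem_cat hk orbT.
  by tauto.
Qed.

Definition agree B (M : structure E) (v w : assignment M) :=
  (forall k, w VF k = v VF k) /\
  (forall n k, (k < B)%N -> w (RV n) k = v (RV n) k).

Lemma agree_sym B M (v w : assignment M) : agree B v w -> agree B w v.
Proof. by case=> h1 h2; split=> *; [rewrite h1|rewrite h2]. Qed.
Lemma agree_trans B M (u v w : assignment M) :
  agree B u v -> agree B v w -> agree B u w.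
Proof.
by move=> [h1 h2] [h3 h4]; split=> *; [rewrite h3 h1|rewrite h4 ?h2].
Qed.
Lemma agree_le B B' M (v w : assignment M) : (B <= B')%N ->
  agree B' v w -> agree B v w.
Proof.
by move=> hB [h1 h2]; split=> // n k hk; rewrite h2 // (leq_trans hk).
Qed.

Lemma supp_bound (L : seq (nat * nat)) :
  exists B, forall n k, (n, k) \in L -> (k < B)%N.
Proof.
elim: L => [|[m l] L [B h]]; first by exists 0%N.
exists (maxn B l.+1) => n k; rewrite inE => /orP [/eqP [_ ->]|/h hk].
  by rewrite leq_max leqnn orbT.
by rewrite leq_max hk.
Qed.

Definition tsupp B s (t : term E s) :=
  forall M (v w : assignment M), agree B v w -> eval_term w t = eval_term v t.

Lemma tsupp_le B B' s (t : term E s) : (B <= B')%N -> tsupp B t -> tsupp B' t.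
Proof. by move=> hB h M v w /(agree_le hB); exact: h. Qed.

Lemma tsupp_ex s (t : term E s) : exists B, tsupp B t.
Proof.
have [L h] := proj1 supp_term_ex s t; have [B hB] := supp_bound L.
by exists B => M v w [h1 h2]; apply: h => // n k /hB; exact: h2.
Qed.

Lemma bound_all (P : nat -> nat -> Prop) k :
  (forall i B B', (B <= B')%N -> P i B -> P i B') ->
  (forall i, exists B, P i B) -> exists B, forall i, (i < k)%N -> P i B.
Proof.
move=> mono ex; elim: k => [|k [B h]]; first by exists 0%N.
have [B' h'] := ex k; exists (maxn B B') => i.
rewrite ltnS leq_eqVlt => /orP [/eqP ->|/h hi].
  by apply: mono h'; exact: leq_maxr.
by apply: mono hi; exact: leq_maxl.
Qed.

Lemma supp_form_bound (p : formula E) : qf p ->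
  exists B, forall M (v w : assignment M), agree B v w -> (sat w p <-> sat v p).
Proof.
move=> /supp_form_ex [L h]; have [B hB] := supp_bound L.
by exists B => M v w [h1 h2]; apply: h => // n k /hB; exact: h2.
Qed.

Lemma upd_same M (v : assignment M) s k a : upd v k a s k = a :> car E M s.
Proof.
rewrite /upd; case: sort_eq_dec => [e|//]; rewrite eqxx.
by rewrite -(Eqdep_dec.eq_rect_eq_dec sort_eq_dec).
Qed.

Lemma upd_other M (v : assignment M) s k (a : car E M s) s' k' :
  (s, k) <> (s', k') -> upd v k a s' k' = v s' k'.
Proof.
rewrite /upd => h; case: sort_eq_dec => [e|//]; case: eqP => // ek.
by case: h; rewrite e ek.
Qed.

Lemma upd_all M (v : assignment M) s k (a : car E M s) w :
  (forall s' k', (s, k) <> (s', k') -> w s' k' = v s' k') -> w s k = a ->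
  upd v k a = w.
Proof.
move=> h1 h2; apply: functional_extensionality_dep => s'.
apply: functional_extensionality => k'.
case: (classic ((s, k) = (s', k'))) => [e|e]; last by rewrite upd_other // h1.
by case: e => <- <-; rewrite upd_same h2.
Qed.

Definition exs (L : seq (nat * nat)) (p : formula E) :=
  foldr (fun nk q => Fex (RV nk.1) nk.2 q) p L.

Lemma exs_noVF L p : qf p -> existential_noVF (exs L p).
Proof. by move=> h; elim: L => //=; case: p h. Qed.

Lemma sat_exs M (v : assignment M) L p : sat v (exs L p) <->
  exists w, [/\ forall k, w VF k = v VF k,
   forall n k, (n, k) \notin L -> w (RV n) k = v (RV n) k & sat w p].
Proof.
elim: L v => [|[n k] L IH] v /=.
  split=> [h|[w [h1 h2 h3]]]; first by exists v.
  suff <- : w = v by [].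
  apply: functional_extensionality_dep => s; apply: functional_extensionality => k.
  by case: s => [|n]; [exact: h1|exact: h2].
split=> [[a /IH [w [h1 h2 h3]]]|[w [h1 h2 h3]]].
  exists w; split=> // m j.
  rewrite inE negb_or => /andP [hj hL]; rewrite h2 // upd_other //.
  by move=> [e1 e2]; move: hj; rewrite e1 e2 eqxx.
exists (w (RV n) k); apply/IH; exists w; split=> // m j hj.
have [[-> ->]|ne] := eqVneq (m, j) (n, k); first by rewrite upd_same.
rewrite upd_other; first by rewrite h2 // inE negb_or ne.
by move=> [e1 e2]; move: ne; rewrite e1 e2 eqxx.
Qed.

(** [agree] leaves infinitely many variables free, but a formula sees finitely many of them, so a
    finite prefix suffices. Any larger list is allowed, which lets two formulas share one prefix. *)
Lemma exists_agree_exs (p : formula E) B : qf p ->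
  exists L0 : seq (nat * nat), forall L, {subset L0 <= L} ->
  forall M (v : assignment M),
  sat v (exs [seq nk <- L | (B <= nk.2)%N] p) <->
  exists w, agree B v w /\ sat w p.
Proof.
move=> /supp_form_ex [L0 h0]; exists L0 => L sL M v; rewrite sat_exs.
split=> [[w [h1 h2 h3]]|[w [[h1 h2] h3]]].
  exists w; split=> //; split=> // n k hk; apply: h2.
  by rewrite mem_filter /= leqNgt hk.
pose w' : assignment M := fun s k =>
  match s with VF => v VF k
  | RV n => if (n, k) \in [seq nk <- L | (B <= nk.2)%N]
            then w (RV n) k else v (RV n) k end.
exists w'; split=> // [n k /negPf /= ->//|].
apply/(h0 M w) => // n k hk /=.
rewrite mem_filter /= (sL _ hk) andbT; case: leqP => // /h2 ->//.
Qed.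

End Substitution.

(** * Closure properties of definable relations *)

Section Definable.
Variables (E : expansion) (X : Type) (str : X -> structure E).
Implicit Types R : forall x, assignment (str x) -> Prop.

(* The RV-variables of index at least [B] are the bound ones, which spares any
   bookkeeping of names. *)
Definition defines R (p : formula E) B := forall x (v : assignment (str x)),
  R x v <-> exists w, agree B v w /\ sat w p.
Definition definable R := exists p B, qf p /\ defines R p B.

Lemma definable_ext R R' : (forall x v, R x v <-> R' x v) ->
  definable R -> definable R'.
Proof.
by move=> h [p [B [q hp]]]; exists p, B; split=> // x v; rewrite -h; exact: hp.
Qed.

Lemma definable_qf p : qf p -> definable (fun x v => sat v p).
Proof.
move=> q; have [B h] := supp_form_bound q; exists p, B; split=> // x v.
split=> [hp|[w [a hp]]]; first by exists v.
by apply/(h _ v w).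
Qed.

Definition ren (rho : nat -> nat) : forall s, nat -> term E s :=
  fun s k => match s return term E s with
  | VF => tvar VF k | RV n => tvar (RV n) (rho k) end.

Section Combine.
Variables (B1 B2 : nat).
Let B := maxn B1 B2.
(** The bound variables of the two formulas are interleaved above [B], at even and at odd offsets,
    so that their witnesses can be chosen independently. *)
Let rho1 k := (if k < B1 then k else B + (k - B1).*2)%N.
Let rho2 k := (if k < B2 then k else B + (k - B2).*2.+1)%N.

Let comb (M : structure E) (v w1 w2 : assignment M) : assignment M := fun s k =>
  match s with VF => v VF k
  | RV n => if (k < B)%N then v (RV n) k else
            if odd (k - B) then w2 (RV n) (B2 + (k - B)./2)%N
            else w1 (RV n) (B1 + (k - B)./2)%N end.

Let comb_agree (M : structure E) (v w1 w2 : assignment M) : agree B v (comb v w1 w2).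
Proof. by split=> //= n k ->. Qed.

Let comb1 (M : structure E) (v w1 w2 : assignment M) : agree B1 v w1 ->
  sub_val (ren rho1) (comb v w1 w2) = w1.
Proof.
move=> [h1 h2]; apply: functional_extensionality_dep => s.
apply: functional_extensionality => k; rewrite /sub_val; case: s => [|n] /=.
  by rewrite h1.
rewrite /rho1; case: (ltnP k B1) => hk.
  by rewrite (leq_trans hk (leq_maxl _ _)) h2.
by rewrite ltnNge leq_addr /= addKn odd_double /= doubleK subnKC.
Qed.

Let comb2 (M : structure E) (v w1 w2 : assignment M) : agree B2 v w2 ->
  sub_val (ren rho2) (comb v w1 w2) = w2.
Proof.
move=> [h1 h2]; apply: functional_extensionality_dep => s.
apply: functional_extensionality => k; rewrite /sub_val; case: s => [|n] /=.
  by rewrite h1.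
rewrite /rho2; case: (ltnP k B2) => hk.
  by rewrite (leq_trans hk (leq_maxr _ _)) h2.
by rewrite ltnNge leq_addr /= addKn /= odd_double /= uphalf_double subnKC.
Qed.

Let agree1 (M : structure E) (v w : assignment M) :
  agree B v w -> agree B1 v (sub_val (ren rho1) w).
Proof.
move=> [h1 h2]; split=> [k|n k hk]; rewrite /sub_val /=; first exact: h1.
by rewrite /rho1 hk h2 // (leq_trans hk (leq_maxl _ _)).
Qed.

Let agree2 (M : structure E) (v w : assignment M) :
  agree B v w -> agree B2 v (sub_val (ren rho2) w).
Proof.
move=> [h1 h2]; split=> [k|n k hk]; rewrite /sub_val /=; first exact: h1.
by rewrite /rho2 hk h2 // (leq_trans hk (leq_maxr _ _)).
Qed.

Lemma defines_and R1 R2 p1 p2 : qf p1 -> qf p2 ->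
  defines R1 p1 B1 -> defines R2 p2 B2 ->
  definable (fun x v => R1 x v /\ R2 x v).
Proof.
move=> q1 q2 d1 d2.
exists (Fand (sub_form (ren rho1) p1) (sub_form (ren rho2) p2)), B.
split; first by rewrite /= !qf_sub q1.
move=> x v; split=> [[/d1 [w1 [a1 s1]] /d2 [w2 [a2 s2]]]|[w [a]] /=].
  exists (comb v w1 w2); split; first exact: comb_agree.
  by split; apply/sat_sub => //; rewrite ?comb1 ?comb2.
move=> [/sat_sub s1 /sat_sub s2]; split.
  by apply/d1; exists (sub_val (ren rho1) w); split; [exact: agree1|exact: s1].
by apply/d2; exists (sub_val (ren rho2) w); split; [exact: agree2|exact: s2].
Qed.

Lemma defines_or R1 R2 p1 p2 : qf p1 -> qf p2 ->
  defines R1 p1 B1 -> defines R2 p2 B2 ->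
  definable (fun x v => R1 x v \/ R2 x v).
Proof.
move=> q1 q2 d1 d2.
exists (For (sub_form (ren rho1) p1) (sub_form (ren rho2) p2)), B.
split; first by rewrite /= !qf_sub q1.
move=> x v; split=> [[/d1 [w [a s]]|/d2 [w [a s]]]|[w [a]] /=].
- exists (comb v w v); split; first exact: comb_agree.
  by left; apply/sat_sub => //; rewrite comb1.
- exists (comb v v w); split; first exact: comb_agree.
  by right; apply/sat_sub => //; rewrite comb2.
move=> [/sat_sub s|/sat_sub s].
  left; apply/d1; exists (sub_val (ren rho1) w).
  by split; [exact: agree1|exact: s].
right; apply/d2; exists (sub_val (ren rho2) w).
by split; [exact: agree2|exact: s].
Qed.
End Combine.

Lemma definable_and R1 R2 : definable R1 -> definable R2 ->
  definable (fun x v => R1 x v /\ R2 x v).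
Proof. by move=> [p1 [B1 [q1 d1]]] [p2 [B2 [q2 d2]]]; exact: defines_and d1 d2. Qed.

Lemma definable_or R1 R2 : definable R1 -> definable R2 ->
  definable (fun x v => R1 x v \/ R2 x v).
Proof. by move=> [p1 [B1 [q1 d1]]] [p2 [B2 [q2 d2]]]; exact: defines_or d1 d2. Qed.

Lemma definable_all k (R : nat -> forall x, assignment (str x) -> Prop) :
  (forall i, (i < k)%N -> definable (R i)) ->
  definable (fun x v => forall i, (i < k)%N -> R i x v).
Proof.
elim: k => [|k IH] h.
  by apply: definable_ext (@definable_qf Ftrue _) => // x v; split.
apply: (@definable_ext (fun x v => (forall i, (i < k)%N -> R i x v) /\ R k x v)).
  move=> x v; split=> [[h1 h2] i|h1].
    by rewrite ltnS leq_eqVlt => /orP [/eqP ->|/h1].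
  by split=> [i hi|]; apply: h1 => //; exact: ltnW.
by apply: definable_and; [apply: IH => i hi; apply: h; exact: ltnW|exact: h].
Qed.

Lemma definable_some k (R : nat -> forall x, assignment (str x) -> Prop) :
  (forall i, (i < k)%N -> definable (R i)) ->
  definable (fun x v => exists i, (i < k)%N /\ R i x v).
Proof.
elim: k => [|k IH] h.
  by apply: definable_ext (@definable_qf Ffalse _) => // x v; split=> // [[i []]].
apply: (@definable_ext (fun x v => (exists i, (i < k)%N /\ R i x v) \/ R k x v)).
  move=> x v; split=> [[[i [hi h1]]|h1]|[i []]].
  - by exists i; split=> //; exact: ltnW.
  - by exists k.
  - rewrite ltnS leq_eqVlt => /orP [/eqP -> h1|hi h1]; first by right.
    by left; exists i.
by apply: definable_or; [apply: IH => i hi; apply: h; exact: ltnW|exact: h].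
Qed.

Lemma definable_exists_agree B R : definable R ->
  definable (fun x v => exists w, agree B v w /\ R x w).
Proof.
move=> [p [B1 [q d]]]; exists p, (minn B B1); split=> // x v.
split=> [[w [a /d [w' [a' s]]]]|[w [a s]]].
  exists w'; split=> //.
  apply: agree_trans (agree_le (geq_minl _ _) a) (agree_le (geq_minr _ _) a').
case: (leqP B B1) => h.
  move: a; rewrite (minn_idPl h) => a; exists w; split=> //.
  by apply/d; exists w.
move: a; rewrite (minn_idPr (ltnW h)) => a; exists v; split=> //.
by apply/d; exists w.
Qed.

Definition updZ (M : structure E) (v : assignment M) n B (Z : nat -> car E M (RV n)) :
    assignment M := fun s k =>
  match sort_eq_dec (RV n) s with
  | left e => if (k < B)%N then v s k else eq_rect _ (car E M) (Z (k - B)%N) s e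
  | right _ => v s k
  end.

Lemma updZ_agree (M : structure E) (v : assignment M) n B Z : agree B v (@updZ M v n B Z).
Proof.
split=> [k|m k hk]; rewrite /updZ; case: sort_eq_dec => // e.
by rewrite hk.
Qed.

Lemma updZ_at (M : structure E) (v : assignment M) n B Z j :
  @updZ M v n B Z (RV n) (B + j)%N = Z j.
Proof.
rewrite /updZ; case: sort_eq_dec => [e|//]; rewrite ltnNge leq_addr /= addKn.
by rewrite -(Eqdep_dec.eq_rect_eq_dec sort_eq_dec).
Qed.

(** A whole sequence can be quantified at once: its entries are stored in the variables of index [B]
    and above, all of which are bound. *)
Lemma definable_existsZ n B
    (R : forall x, assignment (str x) -> (nat -> car E (str x) (RV n)) -> Prop) :
  (forall x v w Z, agree B v w -> R x v Z -> R x w Z) ->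
  definable (fun x v => R x v (fun j => v (RV n) (B + j)%N)) ->
  definable (fun x v => exists Z, R x v Z).
Proof.
move=> hR /(definable_exists_agree B); apply: definable_ext => x v.
split=> [[w [a h]]|[Z h]].
  exists (fun j => w (RV n) (B + j)%N); apply: hR h; exact: agree_sym.
exists (updZ v B Z); split; first exact: updZ_agree.
have -> : (fun j => updZ v B Z (RV n) (B + j)%N) = Z.
  by apply: functional_extensionality => j; rewrite updZ_at.
apply: hR h; exact: updZ_agree.
Qed.

End Definable.

(** * Elimination in Henselian fields *)

(** A function symbol with values in VF takes only VF-arguments, in the expansion as well, so
    VF-terms do not see the RV-variables. *)
Lemma eval_VF_only E (M : structure E) (v w : assignment M) :
  (forall k, w VF k = v VF k) ->
  forall t : term E VF, eval_term w t = eval_term v t.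
Proof.
move=> h.
have [h1 _] : (forall s (t : term E s), s = VF -> eval_term w t = eval_term v t) /\
  (forall ss (ts : targs E ss), all is_VF ss -> eval_targs w ts = eval_targs v ts).
  apply: term_targs_ind => //=.
  - by move=> s k ->.
  - move=> f ts IH hf; rewrite IH //.
    by case: f {ts IH} hf => [[]|c|g].
  - by move=> s ss t IH1 ts IH2 /andP [hs hss]; rewrite IH2 // IH1 //; case: (s) hs.
by move=> t; exact: h1.
Qed.

(** Bundles a natural structure with its field: [definable] refers to an index type of structures,
    and the relations to be defined speak about elements of the field. *)
Record nstruct := NStruct {
  ns :> structure Lbase;
  nK : fieldType;
  nO : {pred nK};
  ne : nK -> car Lbase ns VF;
  nei : car Lbase ns VF -> nK;
  neK : cancel ne nei;
  neiK : cancel nei ne;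
  nVR : valuation_ring nO;
  nhens : henselian nO;
  nch0 : char0 nK;
  ne_0 : fint Lbase ns (Fb VFzero) tt = ne 0;
  ne_1 : fint Lbase ns (Fb VFone) tt = ne 1;
  ne_D : forall x y, fint Lbase ns (Fb VFadd) (ne x, (ne y, tt)) = ne (x + y);
  ne_N : forall x, fint Lbase ns (Fb VFopp) (ne x, tt) = ne (- x);
  ne_M : forall x y, fint Lbase ns (Fb VFmul) (ne x, (ne y, tt)) = ne (x * y);
  nrv := fun n (x : nK) => fint Lbase ns (Fb (Brv n)) (ne x, tt)
         : car Lbase ns (RV n);
  nrv_surj : forall n xi, exists x, nrv n x = xi;
  nrvE : forall n x y, nrv n x = nrv n y <-> rv_eq nO n x y;
  nrv_0 : forall n, fint Lbase ns (Fb (RVzero n)) tt = nrv n 0;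
  nrv_1 : forall n, fint Lbase ns (Fb (RVone n)) tt = nrv n 1;
  nrv_M : forall n x y,
    fint Lbase ns (Fb (RVmul n)) (nrv n x, (nrv n y, tt)) = nrv n (x * y);
  nrv_res : forall n m (H : (n.+1 %| m.+1)%N) x,
    fint Lbase ns (Fb (Brvres H)) (nrv m x, tt) = nrv n x;
  nrv_dvd : forall n xi1 xi2, rint Lbase ns (Rb (RVdvd n)) (xi1, (xi2, tt)) <->
    exists x y, [/\ xi1 = nrv n x, xi2 = nrv n y & vle nO x y];
  nrv_oplus : forall n xi1 xi2 xi3,
    rint Lbase ns (Rb (RVoplus n)) (xi1, (xi2, (xi3, tt))) <->
    exists x1 x2 x3,
      [/\ xi1 = nrv n x1, xi2 = nrv n x2, xi3 = nrv n x3 & x1 + x2 = x3];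
  nrv_P : forall n d xi (zeta : vals (car Lbase ns) (nseq d.+1 (RV (sqi n)))),
    rint Lbase ns (Rb (RVP n d)) (xi, zeta) <->
    exists (x : nK) (a : nat -> nK),
      [/\ xi = nrv n x, zeta = mkvals (fun i => nrv (sqi n) (a i)) d.+1, x != 0,
          Pcond1 nO n d x a & Pcond2 nO n d x a] }.

Lemma natural_nstruct (M : structure Lbase) : natural M ->
  exists x : nstruct, ns x = M.
Proof.
move=> [K [O [e /= [[vr _ he ch [ei eK eiK]] [[e0 e1 eD eN eM]
  [su [rE [r0 [r1 [rM [rr [rd [ro rP]]]]]]]]]]]]].
by exists (NStruct eK eiK vr he ch e0 e1 eD eN eM su rE r0 r1 rM rr rd ro rP).
Qed.

Local Notation tm := (term Lbase).
Definition tzero {E} : term E VF := tapp (Fb VFzero) tnil.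
Definition tone {E} : term E VF := tapp (Fb VFone) tnil.
Definition tadd E (t u : term E VF) : term E VF :=
  tapp (Fb VFadd) (tcons t (tcons u tnil)).
Definition topp E (t : term E VF) : term E VF := tapp (Fb VFopp) (tcons t tnil).
Definition tmul E (t u : term E VF) : term E VF :=
  tapp (Fb VFmul) (tcons t (tcons u tnil)).
Definition tnat n : tm VF := iter n (tadd tone) tzero.
Definition trv E n (t : term E VF) : term E (RV n) := tapp (Fb (Brv n)) (tcons t tnil).
Definition rmul n (t u : tm (RV n)) : tm (RV n) :=
  tapp (Fb (RVmul n)) (tcons t (tcons u tnil)).
Definition rpow n (t : tm (RV n)) k : tm (RV n) :=
  iter k (rmul t) (tapp (Fb (RVone n)) tnil).
Definition rres n m (H : (n.+1 %| m.+1)%N) (t : tm (RV m)) : tm (RV n) :=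
  tapp (Fb (Brvres H)) (tcons t tnil).

Local Notation vars x := (assignment (ns x)).

(** * Sums in RV and polynomials over a natural structure *)

Section Semantics.
Variable x : nstruct.
Local Notation K := (nK x).
Local Notation O := (@nO x).
Local Notation rv := (@nrv x).
Local Notation RVt n := (car Lbase (ns x) (RV n)).
Implicit Types v w : vars x.

Definition vval v (t : tm VF) : K := nei (eval_term v t).
Definition mulRV n (a b : RVt n) : RVt n := fint Lbase x (Fb (RVmul n)) (a, (b, tt)).
Definition powRV n (a : RVt n) k : RVt n := iter k (mulRV a) (rv n 1).
Definition resRV n m (H : (n.+1 %| m.+1)%N) (a : RVt m) : RVt n :=
  fint Lbase x (Fb (Brvres H)) (a, tt).

Lemma val_zero v : vval v tzero = 0.
Proof. by rewrite /vval /= ne_0 neK. Qed.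
Lemma val_add v t u : vval v (tadd t u) = vval v t + vval v u.
Proof.
rewrite /vval /= -{1}(neiK (eval_term v t)) -{1}(neiK (eval_term v u)).
by rewrite ne_D neK.
Qed.
Lemma val_opp v t : vval v (topp t) = - vval v t.
Proof. by rewrite /vval /= -{1}(neiK (eval_term v t)) ne_N neK. Qed.
Lemma val_mul v t u : vval v (tmul t u) = vval v t * vval v u.
Proof.
rewrite /vval /= -{1}(neiK (eval_term v t)) -{1}(neiK (eval_term v u)).
by rewrite ne_M neK.
Qed.
Lemma val_one v : vval v tone = 1.
Proof. by rewrite /vval /= ne_1 neK. Qed.
Lemma val_nat v n : vval v (tnat n) = n%:R.
Proof.
elim: n => [|n IH]; first exact: val_zero.
by rewrite /tnat iterS val_add -/(tnat n) IH -nat1r val_one.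
Qed.
Lemma eval_trv v n t : eval_term v (trv n t) = rv n (vval v t).
Proof. by rewrite /= /nrv /vval neiK. Qed.
Lemma mulRV_rv n a b : mulRV (rv n a) (rv n b) = rv n (a * b).
Proof. exact: nrv_M. Qed.
Lemma powRV_rv n a k : powRV (rv n a) k = rv n (a ^+ k).
Proof.
elim: k => [|k IH]; first by rewrite expr0.
rewrite /powRV iterS -/(powRV _ k) IH mulRV_rv.
by rewrite exprS.
Qed.
Lemma eval_rpow v n t k : eval_term v (rpow t k) = powRV (eval_term v (t : tm (RV n))) k.
Proof.
elim: k => [|k IH]; first exact: nrv_1.
by rewrite /rpow iterS -/(rpow t k) /powRV iterS -/(powRV _ k) -IH.
Qed.
Lemma resRV_rv n m H a : @resRV n m H (rv m a) = rv n a.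
Proof. exact: nrv_res. Qed.

Lemma rv_near n a b : rv n a = rv n b -> vle O a b /\ vle O b a.
Proof. by move/nrvE; apply: rv_eq_near; [exact: nVR|exact: nch0]. Qed.

Lemma rv_dvdE n a b :
  rint Lbase x (Rb (RVdvd n)) (rv n a, (rv n b, tt)) <-> vle O a b.
Proof.
split=> [/nrv_dvd [a' [b' [/rv_near [h1 h2] /rv_near [h3 h4] h]]]|h].
  by apply: vle_trans h1 _; [exact: nVR|apply: vle_trans h h4; exact: nVR].
by apply/nrv_dvd; exists a, b.
Qed.

Lemma rv_eq0 n a : rv n a = rv n 0 <-> a = 0.
Proof. by rewrite nrvE; apply: rv_eq_0; [exact: nVR|exact: nch0]. Qed.

(** The relation $\oplus$ adds two classes only, so a longer sum passes through intermediate
    classes, each step being free to choose new representatives. *)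
Fixpoint chain n d (acc : RVt n) (z : nat -> RVt n) (tau : RVt n) : Prop :=
  if d is d'.+1 then
    exists sg, rint Lbase x (Rb (RVoplus n)) (acc, (z 0%N, (sg, tt))) /\
               chain d' sg (fun i => z i.+1) tau
  else acc = tau.

Lemma chain_ext n d acc (z z' : nat -> RVt n) tau :
  (forall i, (i < d)%N -> z i = z' i) -> chain d acc z tau -> chain d acc z' tau.
Proof.
elim: d acc z z' => //= d IH acc z z' h [sg [h1 h2]].
exists sg; rewrite -h //; split=> //; apply: IH h2 => i hi; exact: h.
Qed.

Lemma chain_complete n d s (a : nat -> K) :
  chain d (rv n s) (fun i => rv n (a i)) (rv n (s + \sum_(0 <= i < d) a i)).
Proof.
elim: d s a => [|d IH] s a /=; first by rewrite big_geq // addr0.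
exists (rv n (s + a 0%N)); split.
  by apply/nrv_oplus; exists s, (a 0%N), (s + a 0%N).
rewrite big_nat_recl // addrA; exact: IH.
Qed.

(* Along the chain the error committed by choosing other representatives stays
   smaller than the fixed threshold [T]. *)
Lemma chain_sound n d s s' t T (a : nat -> K) : T != 0 ->
  vle O T (n.+1%:R * s') -> (forall i, (i < d)%N -> vle O T (n.+1%:R * a i)) ->
  vlt O T (s' - s) -> chain d (rv n s') (fun i => rv n (a i)) (rv n t) ->
  vlt O T (t - (s + \sum_(0 <= i < d) a i)).
Proof.
have VR := nVR x; have ch0 := nch0 x => T0.
elim: d s s' a => [|d IH] s s' a hs ha hss /=.
  move/nrvE => h; rewrite big_geq // addr0.
  have -> : t - s = (t - s') + (s' - s) by ring.
  by apply: vlt_D => //; exact: rv_eq_vlt_sub h.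
move=> [sg [/nrv_oplus [x1 [x2 [x3 [/nrvE e1 /nrvE e2 -> e3]]]] h]].
have l1 : vlt O T (x1 - s') by exact: rv_eq_vlt_sub e1.
have l2 : vlt O T (x2 - a 0%N) by apply: rv_eq_vlt_sub e2 => //; exact: ha.
rewrite big_nat_recl // addrA; apply: IH h => //.
- rewrite -e3 mulrDr; apply: vle_D => //.
    have -> : x1 = (x1 - s') + s' by ring.
    rewrite mulrDr; apply: vle_D => //; apply: vle_trans (vltW VR l1) _ => //.
    exact: vle_nat.
  have -> : x2 = (x2 - a 0%N) + a 0%N by ring.
  rewrite mulrDr; apply: vle_D => //; last exact: ha.
  apply: vle_trans (vltW VR l2) _ => //; exact: vle_nat.
- by move=> i hi; exact: ha.
have -> : x3 - (s + a 0%N) = (x1 - s') + ((x2 - a 0%N) + (s' - s)).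
  by rewrite -e3; ring.
by apply: vlt_D => //; apply: vlt_D.
Qed.

(* [z 0 + ... + z d.-1] has [rv_m] equal to [eta], at most [C] being lost by
   cancellation. *)
Definition nosum n m (H : (m.+1 %| n.+1)%N) C d (z : nat -> RVt n) (eta : RVt m) :=
  exists tau : RVt n, [/\ chain d (rv n 0) z tau,
    forall i, (i < d)%N ->
      rint Lbase x (Rb (RVdvd n)) (tau, (mulRV (rv n C%:R) (z i), tt)) &
    resRV H tau = eta].

Lemma nosum_complete n m H C d (a : nat -> K) :
  let S := \sum_(0 <= i < d) a i in
  (forall i, (i < d)%N -> vle O S (C%:R * a i)) ->
  @nosum n m H C d (fun i => rv n (a i)) (rv m S).
Proof.
move=> S h; exists (rv n S); split; last exact: resRV_rv.
  by have := chain_complete n d 0 a; rewrite add0r.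
by move=> i hi; rewrite mulRV_rv; apply/rv_dvdE; exact: h.
Qed.

(** Write $n+1=c\,C(m+1)$ and let $t$ represent the class [tau]. The threshold $T=c(m+1)t$ is at
    most every $(n+1)a_i$ in order, by the loss condition; an error beyond $T$ is beyond $(m+1)t$
    and hence invisible at level $m+1$. *)
Lemma nosum_sound n m H C d (a : nat -> K) eta : (C * m.+1 %| n.+1)%N ->
  @nosum n m H C d (fun i => rv n (a i)) eta ->
  rv m (\sum_(0 <= i < d) a i) = eta.
Proof.
have VR := nVR x; have ch0 := nch0 x.
move=> /dvdnP [c hc] [tau [h1 h2 <-]].
have [t et] := nrv_surj tau; rewrite -et in h1 h2 *; rewrite resRV_rv.
have {}h2 i : (i < d)%N -> vle O t (C%:R * a i).
  by move=> /h2; rewrite mulRV_rv => /rv_dvdE.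
have [t0|t0] := eqVneq t 0.
  have C0 : C%:R != 0 :> K.
    by apply: natr_neq0 => //; move: hc; case: C {h2} => //; rewrite mul0n muln0.
  rewrite t0 big_nat big1 // => i hi; have := h2 i hi.
  by rewrite t0 vle_0l mulf_eq0 (negPf C0) => /eqP.
apply/nrvE/rv_eq_sym => //; apply/rv_eqP => //; right.
have N0 : (c * m.+1)%:R != 0 :> K.
  apply: natr_neq0 => //; rewrite muln_gt0 andbT.
  by move: hc; case: c => //; rewrite mul0n.
have ht : vlt O ((c * m.+1)%:R * t) (t - (0 + \sum_(0 <= i < d) a i)).
  apply: (chain_sound (n := n) (s' := 0)) => //.
  - by rewrite mulf_neq0.
  - by rewrite mulr0 vle_0.
  - move=> i /h2 h.
    have -> : n.+1%:R * a i = (c * m.+1)%:R * (C%:R * a i).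
      by rewrite hc !natrM; ring.
    by apply: vle_mul => //; exact: vle_refl.
  - by rewrite subr0 vlt_0 // mulf_neq0.
move: ht; rewrite add0r => ht; rewrite -opprB vlt_N //.
by apply: vle_lt_trans ht => //; apply: vle_natdvd => //; exact: dvdn_mull.
Qed.

Definition pv v (g : seq (tm VF)) : {poly K} :=
  \poly_(i < size g) vval v (nth tzero g i).

Lemma coef_pv v g i : (pv v g)`_i = vval v (nth tzero g i).
Proof.
by rewrite coef_poly; case: ltnP => // h; rewrite nth_default // val_zero.
Qed.

Lemma size_pv v g : (size (pv v g) <= size g)%N.
Proof. exact: size_poly. Qed.

Lemma pv_agree v w g : (forall k, w VF k = v VF k) -> pv w g = pv v g.
Proof. by move=> h; apply/polyP => i; rewrite !coef_pv /vval (eval_VF_only h). Qed.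

End Semantics.

(** The Hasse derivative of index [j], formed on coefficient terms, so that the derivatives
    providing centres are again polynomials over the language. *)
Definition nd j (g : seq (tm VF)) : seq (tm VF) :=
  mkseq (fun i => tmul (tnat 'C(j + i, j)) (nth tzero g (j + i))) (size g - j).

Lemma size_nd j g : size (nd j g) = (size g - j)%N.
Proof. by rewrite size_mkseq. Qed.

Lemma pv_nd (x : nstruct) (v : vars x) j g : pv v (nd j g) = (pv v g)^`N(j).
Proof.
apply/polyP => i; rewrite coef_nderivn !coef_pv.
case: (ltnP i (size g - j)) => h.
  by rewrite nth_mkseq // val_mul val_nat mulr_natl.
rewrite nth_default ?size_nd // nth_default; last by lia.
by rewrite !val_zero mul0rn.
Qed.

(** Pseudo-division: the leading coefficient of [q] is a term and cannot be inverted, so each step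
    multiplies by it and the exponent is recorded. The remainder is the same for all structures and
    assignments. *)
Lemma reduce_mod e (q g : seq (tm VF)) : size q = e.+1 ->
  {kr : nat * seq (tm VF) | (size kr.2 <= e)%N /\
    forall (x : nstruct) (v : vars x) b, root (pv v q) b ->
     (pv v kr.2).[b] = (pv v g).[b] * vval v (nth tzero q e) ^+ kr.1}.
Proof.
move=> hq; have [n hn] := ubnP (size g); elim: n g hn => // n IH g hn.
case: (leqP (size g) e) => hg.
  by exists (0%N, g); split=> // x v b _; rewrite expr0 mulr1.
pose s := (size g - e.+1)%N.
have hs : size g = (e + s).+1 by rewrite /s; lia.
pose a := nth tzero q e; pose l := nth tzero g (e + s).
pose g' := mkseq (fun i => tadd (tmul a (nth tzero g i))
  (topp (if (s <= i)%N then tmul l (nth tzero q (i - s)) else tzero))) (e + s).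
have [|[k r] /= [hr h]] := IH g'; first by rewrite size_mkseq; lia.
exists (k.+1, r) => /=; split=> // x v b rb; rewrite h // exprS mulrA.
congr (_ * _); suff -> : pv v g' = vval v a *: pv v g - vval v l *: (pv v q * 'X^s).
  rewrite hornerD hornerN !hornerZ hornerM; move: rb; rewrite /root => /eqP ->.
  by rewrite mul0r mulr0 subr0 mulrC.
apply/polyP => i; rewrite coefB !coefZ coefMXn !coef_pv.
case: (ltngtP i (e + s)%N) => hi.
- rewrite nth_mkseq // val_add val_opp val_mul; case: ltnP => h1.
    by rewrite val_zero mulr0.
  by rewrite val_mul.
- rewrite !nth_default ?size_mkseq ?hs ?hq //; try lia.
  by rewrite !val_zero !mulr0; case: ifP => _; rewrite ?mulr0 subrr.
- rewrite hi nth_default ?size_mkseq // val_zero ltnNge leq_addl /= addnK.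
  by rewrite -/a -/l mulrC subrr.
Qed.

Local Notation def := (@definable Lbase nstruct ns).

Lemma definable_chain n d (acc tau : tm (RV n)) (z : nat -> tm (RV n)) :
  def (fun x v => chain d (eval_term v acc) (fun i => eval_term v (z i))
                    (eval_term v tau)).
Proof.
elim: d acc z => [|d IH] acc z /=; first exact: (@definable_qf _ _ _ (Feq acc tau)).
have [B1 h1] := tsupp_ex acc; have [B2 h2] := tsupp_ex tau.
have [B3 h3] : exists B, forall i, (i < d.+1)%N -> tsupp B (z i).
  apply: (bound_all (P := fun i B => tsupp B (z i))) => [i B B'|i].
    exact: tsupp_le.
  exact: tsupp_ex.
pose B := maxn B1 (maxn B2 B3).
have {}h1 : tsupp B acc by apply: tsupp_le h1; rewrite /B; lia.
have {}h2 : tsupp B tau by apply: tsupp_le h2; rewrite /B; lia.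
have {}h3 i : (i < d.+1)%N -> tsupp B (z i).
  by move=> /h3 h; apply: tsupp_le h; rewrite /B; lia.
(* Of the quantified sequence only [Z 0] is used, as the next partial sum. *)
pose R x (v : vars x) (Z : nat -> car Lbase x (RV n)) :=
  rint Lbase x (Rb (RVoplus n)) (eval_term v acc, (eval_term v (z 0%N), (Z 0%N, tt)))
  /\ chain d (Z 0%N) (fun i => eval_term v (z i.+1)) (eval_term v tau).
apply: (@definable_ext _ _ _ (fun x v => exists Z, R x v Z)).
  move=> x v; split=> [[Z [r1 r2]]|[sg [r1 r2]]]; first by exists (Z 0%N).
  by exists (fun=> sg).
apply: (@definable_existsZ _ _ _ n B R) => [x v w Z ag [r1 r2]|].
  rewrite /R (h1 _ _ _ ag) (h2 _ _ _ ag) (h3 0%N _ _ _ _ ag) //; split=> //.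
  by apply: chain_ext r2 => i hi; rewrite (h3 i.+1 _ _ _ _ ag).
apply: definable_and.
  exact: (@definable_qf _ _ _ (@Frel Lbase (Rb (RVoplus n))
    (tcons acc (tcons (z 0%N) (tcons (tvar (RV n) (B + 0)%N) tnil))))).
exact: (IH (tvar (RV n) (B + 0)%N) (fun i => z i.+1)).
Qed.

Lemma nosum_ext (x : nstruct) n m H C d (z z' : nat -> car Lbase x (RV n)) eta :
  (forall i, (i < d)%N -> z i = z' i) ->
  @nosum x n m H C d z eta -> nosum H C d z' eta.
Proof.
move=> h [tau [h1 h2 h3]]; exists tau; split=> //; first exact: chain_ext h1.
by move=> i hi; rewrite -h //; exact: h2.
Qed.

Lemma definable_nosum n m (H : (m.+1 %| n.+1)%N) C d (z : nat -> tm (RV n))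
    (eta : tm (RV m)) :
  def (fun x v => nosum H C d (fun i => eval_term v (z i)) (eval_term v eta)).
Proof.
have [B1 h1] := tsupp_ex eta.
have [B2 h2] : exists B, forall i, (i < d)%N -> tsupp B (z i).
  apply: (bound_all (P := fun i B => tsupp B (z i))) => [i B B'|i].
    exact: tsupp_le.
  exact: tsupp_ex.
pose B := maxn B1 B2.
have {}h1 : tsupp B eta by apply: tsupp_le h1; rewrite /B; lia.
have {}h2 i : (i < d)%N -> tsupp B (z i).
  by move=> /h2 h; apply: tsupp_le h; rewrite /B; lia.
pose R x (v : vars x) (Z : nat -> car Lbase x (RV n)) :=
  chain d (nrv n 0) (fun i => eval_term v (z i)) (Z 0%N) /\
  ((forall i, (i < d)%N -> rint Lbase x (Rb (RVdvd n))
     (Z 0%N, (mulRV (nrv n C%:R) (eval_term v (z i)), tt))) /\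
   resRV H (Z 0%N) = eval_term v eta).
apply: (@definable_ext _ _ _ (fun x v => exists Z, R x v Z)).
  move=> x v; split=> [[Z [r1 [r2 r3]]]|[tau [r1 r2 r3]]]; first by exists (Z 0%N).
  by exists (fun=> tau).
apply: (@definable_existsZ _ _ _ n B R) => [x v w Z ag [r1 [r2 r3]]|].
  rewrite /R (h1 _ _ _ ag); split; last first.
    by split=> // i hi; rewrite (h2 i hi _ _ _ ag); exact: r2.
  by apply: chain_ext r1 => i hi; rewrite (h2 i hi _ _ _ ag).
pose t : tm (RV n) := tvar (RV n) (B + 0)%N.
apply: definable_and; [|apply: definable_and].
- apply: definable_ext (definable_chain d (trv n tzero) t z) => x v.
  by rewrite eval_trv val_zero.
- apply: definable_all => i hi.
  pose p := @Frel Lbase (Rb (RVdvd n))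
    (tcons t (tcons (rmul (trv n (tnat C)) (z i)) tnil)).
  apply: (@definable_ext _ _ _ (fun x v => sat v p)); last exact: definable_qf.
  by move=> x v; rewrite -(val_nat v C) -eval_trv.
- exact: (@definable_qf _ _ _ (Feq (rres H t) eta)).
Qed.

Fixpoint mktargs s (f : nat -> tm s) k : targs Lbase (nseq k s) :=
  if k is k'.+1 return targs Lbase (nseq k s)
  then tcons (f 0%N) (mktargs (fun i => f i.+1) k') else tnil.

Lemma eval_mktargs (M : structure Lbase) (v : assignment M) s (f : nat -> tm s) k :
  eval_targs v (mktargs f k) = mkvals (fun i => eval_term v (f i)) k.
Proof. by elim: k f => //= k IH f; rewrite IH. Qed.

Lemma mkvals_inj (T : Defs.sort -> Type) s (f g : nat -> T s) k :
  mkvals f k = mkvals g k -> forall i, (i < k)%N -> f i = g i.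
Proof.
elim: k f g => //= k IH f g [h1 /IH h2] [|i] // hi.
exact: (h2 i).
Qed.

Lemma mkvals_ext (T : Defs.sort -> Type) s (f g : nat -> T s) k :
  (forall i, (i < k)%N -> f i = g i) -> mkvals f k = mkvals g k.
Proof.
elim: k f g => //= k IH f g h; rewrite h // (IH _ (fun i => g i.+1)) //.
by move=> i hi; exact: h.
Qed.

(** * One elimination step *)

Section Step.
Variables (e k m : nat) (eqn : bool) (q : seq (tm VF)) (r : nat -> seq (tm VF)).
Variable eta : nat -> tm (RV m).
Hypothesis hq : (size q <= e.+1)%N.
Hypothesis hr : forall i, (size (r i) <= e)%N.

(* The level [n1.+1] absorbs the loss [cbound e] at a centre, the factors
   [1, ..., e] introduced by differentiation, and the target level [m.+1]. *)
Let n1 := (m.+1 * (cbound e * e`!)).-1.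
Let sq := sqi n1.

Let n1S : n1.+1 = (m.+1 * (cbound e * e`!))%N.
Proof. by rewrite /n1 prednK // !muln_gt0 cbound_gt0 fact_gt0. Qed.
Let H1 : (m.+1 %| n1.+1)%N. Proof. by rewrite n1S dvdn_mulr. Qed.
Let H2 : (n1.+1 %| sq.+1)%N.
Proof. by rewrite /sq /sqi prednK ?expn_gt0 // -mulnn dvdn_mulr. Qed.
Let H3 : (m.+1 %| sq.+1)%N. Proof. exact: dvdn_trans H1 H2. Qed.

(** [F] lists the polynomials whose Taylor coefficients are recorded, and [H] flattens these
    coefficients into one sequence. [G] lists the derivatives whose roots serve as centres; it
    starts from $q'$ instead of $q$, which keeps all sizes at most [e]. *)
Let F i := if i is i'.+1 then r i' else q.
Let G i j := nd j (if i is i'.+1 then r i' else nd 1 q).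
Let H l := nd (l %% e.+1) (F (l %/ e.+1)).
Let idx i j := (i * e.+1 + j)%N.
Let L := (k.+1 * e.+1)%N.

Let H_idx i j : (j < e.+1)%N -> H (idx i j) = nd j (F i).
Proof.
by move=> hj; rewrite /H /idx modnMDl divnMDl // modn_small // divn_small // addn0.
Qed.

Let idx_lt i j : (i < k.+1)%N -> (j < e.+1)%N -> (idx i j < L)%N.
Proof.
move=> hi hj; apply: (@leq_trans (i.+1 * e.+1)); last by rewrite leq_mul2r hi orbT.
by rewrite /idx mulSn addnC ltn_add2r.
Qed.

(* [Z] lists the [rv] of the Taylor coefficients, at a centre [b], of [q] and
   of the [r i], followed by [rv (y - b)] at index [L]; the case [y = b] is
   [Phi0]. *)
Let Phi0 (x : nstruct) (v : vars x) (Z : nat -> car Lbase x (RV sq)) :=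
  (eqn -> Z 0%N = nrv sq 0) /\
  forall i, (i < k)%N -> resRV H3 (Z (idx i.+1 0)) = eval_term v (eta i).

Let Phi1 (x : nstruct) (v : vars x) (Z : nat -> car Lbase x (RV sq)) :=
  (eqn -> rint Lbase x (Rb (RVP n1 e)) (resRV H2 (Z L), mkvals Z e.+1)) /\
  forall i, (i < k)%N -> nosum H1 (cbound e) e.+1
    (fun j => mulRV (resRV H2 (Z (idx i.+1 j))) (powRV (resRV H2 (Z L)) j))
    (eval_term v (eta i)).

Let Rel (x : nstruct) (v : vars x) b Z :=
  (forall l, (l < L)%N -> nrv sq (pv v (H l)).[b] = Z l) /\
  (Phi0 v Z \/ Phi1 v Z).

Let cen (x : nstruct) (v : vars x) b := b = 0 \/
  exists i, (i < k.+1)%N /\ exists j, (j < e.+1)%N /\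
    pv v (G i j) != 0 /\ root (pv v (G i j)) b.

Let goal (x : nstruct) (v : vars x) :=
  exists y, (eqn -> root (pv v q) y) /\
    forall i, (i < k)%N -> nrv m (pv v (r i)).[y] = eval_term v (eta i).

Let Rel_coef x v b Z i j : @Rel x v b Z -> (i < k.+1)%N -> (j < e.+1)%N ->
  nrv sq (pv v (F i))^`N(j).[b] = Z (idx i j).
Proof.
by move=> [h _] hi hj; rewrite -h ?idx_lt // H_idx // pv_nd.
Qed.

(** Works at every [b], since the relations carry their own guarantee: [nosum] includes the test
    that little is lost, and $P_{N,d}$ includes the condition for Newton's method. In the case of an
    equation the representative of [Z L] is replaced by one that makes $b+z$ an exact root. *)
Let Rel_sound x v b Z : @Rel x v b Z -> goal v.
Proof.
move=> hR; have hc := Rel_coef hR; case: hR => _ [[h1 h2]|[h1 h2]].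
  exists b; split=> [/h1 e0|i hi].
    have := hc 0%N 0%N isT isT; rewrite nderivn0 e0 => /rv_eq0 h.
    by rewrite /root h.
  by rewrite -(h2 i hi) -(hc i.+1 0%N) // resRV_rv nderivn0.
have VR := nVR x; have ch0 := nch0 x.
have [z ez rz] : exists2 z, nrv n1 z = resRV H2 (Z L) &
    (eqn -> root (pv v q) (b + z)).
  have [z0 e0] := nrv_surj (Z L); rewrite -e0 in h1 *; rewrite resRV_rv in h1 *.
  case: (eqn) h1 => [h1|_]; last by exists z0.
  have /nrv_P [x0 [a [e1 e2 x00 P1 P2]]] := h1 isT.
  have [i hi|z ze qz] := root_of_Pcond VR (@nhens x) ch0 (q := pv v q) (b := b)
    (leq_trans (size_pv v q) hq) x00 _ P1 P2.
    by apply/nrvE; rewrite -(mkvals_inj e2) // (hc 0%N).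
  by exists z; rewrite ?e1 /root ?qz //; apply/nrvE; apply: rv_eq_sym.
exists (b + z); split=> // i hi.
pose a j := (pv v (r i))^`N(j).[b] * z ^+ j.
have -> : (pv v (r i)).[b + z] = \sum_(0 <= j < e.+1) a j.
  rewrite (@nderivn_horner_widen _ _ e.+1) ?big_mkord //.
  by rewrite (leq_trans (size_pv v _)) // ltnW // ltnS.
apply: (@nosum_sound x n1 m H1 (cbound e)).
  by rewrite n1S mulnA [(m.+1 * _)%N]mulnC dvdn_mulr.
apply: nosum_ext (h2 i hi) => j hj.
by rewrite -(hc i.+1 j) // resRV_rv -ez powRV_rv mulRV_rv.
Qed.

(** A common centre near [y] of $q'$ and all [r i] supplies the data: for $q'$ it yields $P_{N,d}$,
    for [r i] the bounded loss in [nosum]. *)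
Let Rel_complete x v : goal v -> exists b, @cen x v b /\ exists Z, Rel v b Z.
Proof.
move=> [y [hy hi]]; have VR := nVR x; have ch0 := nch0 x.
pose p i := if i is i'.+1 then pv v (r i') else (pv v q)^`().
have pG i j : (p i)^`N(j) = pv v (G i j).
  by rewrite /G pv_nd; case: i => //=; rewrite pv_nd nderivn1.
have sp i : (size (p i) <= e)%N.
  case: i => [|i] /=; last by rewrite (leq_trans (size_pv v _)).
  have [->|q0] := eqVneq (pv v q) 0; first by rewrite deriv0 size_poly0.
  by rewrite -ltnS (leq_trans (lt_size_deriv q0)) // (leq_trans (size_pv v _)).
have [b cb nc] := common_centre VR (@nhens x) ch0 y (fun i (_ : (i < k.+1)%N) => sp i).
exists b; split.
  case: cb => [->|[i [i1 [j [hj rj]]]]]; [by left|right].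
  exists i; split=> //; exists j; rewrite -pG; split=> //.
  rewrite ltnS leqNgt; apply: contraNN hj => hj.
  by rewrite nderivn_poly0 // (leq_trans (sp i)) // ltnW.
(* Separated because $P_{N,d}$ requires its first argument, here the class of $y-b$, to be
   nonzero. *)
have [yb|yb] := eqVneq y b.
  exists (fun l => nrv sq (pv v (H l)).[b]); split=> //; left; split=> [he|i ik].
    rewrite -[0%N]/(idx 0 0) H_idx // pv_nd nderivn0 -yb.
    by move: (hy he); rewrite /root => /eqP ->.
  by rewrite H_idx // pv_nd nderivn0 resRV_rv -yb hi.
pose z := y - b; have z0 : z != 0 by rewrite subr_eq0.
have yE : b + z = y by rewrite /z addrC subrK.
pose Z l := if (l < L)%N then nrv sq (pv v (H l)).[b] else nrv sq z.
have ZL : Z L = nrv sq z by rewrite /Z ltnn.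
have Zc i j : (i < k.+1)%N -> (j < e.+1)%N ->
    Z (idx i j) = nrv sq (pv v (F i))^`N(j).[b].
  by move=> h1 h2; rewrite /Z idx_lt // H_idx // pv_nd.
exists Z; split; first by move=> l hl; rewrite /Z hl.
right; split=> [he|i ik].
  apply/nrv_P; exists z, (fun i => (pv v q)^`N(i).[b]).
  have [P1 P2] : Pcond1 (@nO x) n1 e z (fun i => (pv v q)^`N(i).[b]) /\
      Pcond2 (@nO x) n1 e z (fun i => (pv v q)^`N(i).[b]).
    apply: (@Pcond_of_root _ _ VR ch0 n1 e (cbound e)).
    - by rewrite (leq_trans (size_pv v _)).
    - by apply/eqP; rewrite yE; exact: hy.
    - by rewrite yE; exact: (nc 0%N).
    - by rewrite n1S dvdn_mull.
  split=> //; first by rewrite ZL resRV_rv.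
  by apply: mkvals_ext => i ie; rewrite -(Zc 0%N i).
pose a j := (pv v (r i))^`N(j).[b] * z ^+ j.
have aE : (pv v (r i)).[y] = \sum_(0 <= j < e.+1) a j.
  rewrite -yE (@nderivn_horner_widen _ _ e.+1) ?big_mkord //.
  by rewrite (leq_trans (size_pv v _)) // ltnW // ltnS.
rewrite -(hi i ik) aE.
have h := @nosum_complete x n1 m H1 (cbound e) e.+1 a.
apply: nosum_ext (h _) => j hj.
  by rewrite ZL Zc // !resRV_rv powRV_rv mulRV_rv.
by rewrite -aE; exact: (nc i.+1).
Qed.

Let eta_supp : exists B, forall i, (i < k)%N -> tsupp B (eta i).
Proof.
apply: (bound_all (P := fun i B => tsupp B (eta i))) => [i B B'|i].
  exact: tsupp_le.
exact: tsupp_ex.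
Qed.

Let Phi_agree B : (forall i, (i < k)%N -> tsupp B (eta i)) ->
  forall (x : nstruct) (v w : vars x) Z, agree B v w ->
  Phi0 v Z \/ Phi1 v Z -> Phi0 w Z \/ Phi1 w Z.
Proof.
move=> hB x v w Z ag [[h1 h2]|[h1 h2]]; [left|right]; split=> // i ik;
  rewrite (hB i ik _ _ _ ag); exact: h2.
Qed.

Let definable_Phi B : def (fun x v =>
  Phi0 v (fun j => v (RV sq) (B + j)%N) \/ Phi1 v (fun j => v (RV sq) (B + j)%N)).
Proof.
pose T j : tm (RV sq) := tvar (RV sq) (B + j)%N.
have dT : def (fun x v => True) by exact: (@definable_qf _ _ _ Ftrue).
apply: definable_or; apply: definable_and.
- case: (eqn); last by apply: definable_ext dT => x v; split.
  pose p := Feq (T 0%N) (trv sq tzero).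
  apply: (@definable_ext _ _ _ (fun x v => sat v p)); last exact: definable_qf.
  move=> x v; rewrite -(val_zero v) -eval_trv; split=> [h _|/(_ isT)]; exact.
- apply: definable_all => i ik.
  exact: (@definable_qf _ _ _ (Feq (rres H3 (T (idx i.+1 0))) (eta i))).
- case: (eqn); last by apply: definable_ext dT => x v; split.
  pose p := @Frel Lbase (Rb (RVP n1 e)) (tcons (rres H2 (T L)) (mktargs T e.+1)).
  apply: (@definable_ext _ _ _ (fun x v => sat v p)); last exact: definable_qf.
  move=> x v; rewrite /p /= !eval_mktargs; split=> [h _|/(_ isT)]; exact.
- apply: definable_all => i ik.
  pose zt j := rmul (rres H2 (T (idx i.+1 j))) (rpow (rres H2 (T L)) j).
  apply: definable_ext (definable_nosum H1 (cbound e) e.+1 zt (eta i)) => x v.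
  have E j : eval_term v (zt j) = mulRV (resRV H2 (v (RV sq) (B + idx i.+1 j)%N))
      (powRV (resRV H2 (v (RV sq) (B + L)%N)) j).
    by rewrite -[resRV H2 (v (RV sq) (B + L)%N)]/(eval_term v (rres H2 (T L))) -eval_rpow.
  by split; apply: nosum_ext => j _; rewrite E.
Qed.

(** The induction hypothesis of [definable_roots]. As an assumption of the section it lets the same
    step serve with and without an equation for [y]. *)
Hypothesis roots : forall k' m' h (g : nat -> seq (tm VF)) (zeta : nat -> tm (RV m')),
  (size h <= e)%N -> def (fun x v => exists b, pv v h != 0 /\ root (pv v h) b /\
    forall i, (i < k')%N -> nrv m' (pv v (g i)).[b] = eval_term v (zeta i)).

(** Moves the RV-quantifier for [Z] in front of the one for [b]. What remains about [b] is a list of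
    prescribed values of [nrv] at polynomials in [b], which is the shape that [roots] can handle. *)
Let definable_at (P : forall x : nstruct, vars x -> nK x -> Prop) :
  (forall x v w b, (forall j, w VF j = v VF j) -> P x v b -> P x w b) ->
  (forall zeta : nat -> tm (RV sq),
    def (fun x v => exists b, P x v b /\
    forall i, (i < L)%N -> nrv sq (pv v (H i)).[b] = eval_term v (zeta i))) ->
  def (fun x v => exists b, P x v b /\ exists Z, Rel v b Z).
Proof.
move=> hP hd; have [B hB] := eta_supp.
pose R (x : nstruct) (v : vars x) (Z : nat -> car Lbase x (RV sq)) :=
  (exists b, P x v b /\ forall i, (i < L)%N -> nrv sq (pv v (H i)).[b] = Z i) /\
  (Phi0 v Z \/ Phi1 v Z).
apply: (@definable_ext _ _ _ (fun x v => exists Z, R x v Z)).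
  move=> x v; split=> [[Z [[b [h1 h2]] h3]]|[b [h1 [Z [h2 h3]]]]].
    by exists b; split=> //; exists Z.
  by exists Z; split=> //; exists b.
apply: (@definable_existsZ _ _ _ sq B R) => [x v w Z ag [[b [h1 h2]] h3]|].
  split; last exact: Phi_agree ag h3.
  case: (ag) => ag1 _.
  exists b; split; first exact: hP h1.
  by move=> i iL; rewrite (pv_agree _ ag1); exact: h2.
by apply: definable_and; [exact: (hd (fun i => tvar (RV sq) (B + i)%N))|
  exact: definable_Phi].
Qed.

Lemma definable_step : def (@goal).
Proof.
apply: (@definable_ext _ _ _ (fun x v =>
  (exists b, b = 0 /\ exists Z, Rel v b Z) \/
  exists i, (i < k.+1)%N /\ exists j, (j < e.+1)%N /\ exists b,
  (pv v (G i j) != 0 /\ root (pv v (G i j)) b) /\ exists Z, Rel v b Z)).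
  move=> x v; split.
    by move=> [[b [_ [Z /Rel_sound //]]]|[i [_ [j [_ [b [_ [Z /Rel_sound]]]]]]]].
  move=> /Rel_complete [b [[b0|[i [hi [j [hj hG]]]]] hZ]]; [left|right].
    by exists b.
  by exists i; split=> //; exists j; split=> //; exists b.
apply: definable_or.
  apply: definable_at => // zeta.
  (* At the centre 0 the Taylor coefficients are the coefficient terms themselves. *)
  apply: (@definable_ext _ _ _ (fun x v => forall i, (i < L)%N ->
    sat v (Feq (trv sq (nth tzero (H i) 0)) (zeta i)))).
    move=> x v; split=> [h|[b [-> h]] i iL].
      exists 0; split=> // i iL; have := h i iL.
      by rewrite /= horner_coef0 coef_pv -eval_trv.
    by have := h i iL; rewrite /= horner_coef0 coef_pv -eval_trv.
  by apply: definable_all => i _; exact: definable_qf.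
apply: definable_some => i _; apply: definable_some => j _.
apply: definable_at => [x v w b h|zeta]; first by rewrite !(pv_agree _ h).
have sG : (size (G i j) <= e)%N.
  rewrite /G size_nd; apply: leq_trans (leq_subr _ _) _.
  by case: (i) => [|i'] //; rewrite size_nd leq_subLR add1n.
apply: definable_ext (@roots L sq (G i j) H zeta sG) => x v.
split=> [[b [h1 [h2 h3]]]|[b [[h1 h2] h3]]]; by exists b.
Qed.

End Step.

(** Induction on the formal size of [q], split by its leading coefficient [a]. If [a] vanishes, [q]
    is truncated. Otherwise pseudo-division makes all [g i] smaller than [q], and the elimination
    step only needs roots of polynomials of size at most [e]. *)
Lemma definable_roots e : forall k m q (g : nat -> seq (tm VF)) (eta : nat -> tm (RV m)),
  (size q <= e)%N -> def (fun x v => exists b, pv v q != 0 /\ root (pv v q) b /\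
    forall i, (i < k)%N -> nrv m (pv v (g i)).[b] = eval_term v (eta i)).
Proof.
elim: e => [|e IH] k m q g eta hq.
  apply: (@definable_ext _ _ _ (fun x v => sat v Ffalse)); last exact: definable_qf.
  move=> x v; split=> // [[b [h _]]]; move: h.
  by rewrite -size_poly_gt0 ltnNge (leq_trans (size_pv v q)).
have [hq'|hq'] := leqP (size q) e; first exact: IH.
have {}hq' : size q = e.+1 by apply/eqP; rewrite eqn_leq hq.
pose a := nth tzero q e.
pose kr i := sval (reduce_mod (g i) hq').
have krP i := svalP (reduce_mod (g i) hq').
(* Pseudo-division multiplies the value of [g i] by a power of [a], so its prescribed class is
   multiplied likewise; for nonzero [a] this can be undone. *)
pose eta' i := rmul (eta i) (rpow (trv m a) (kr i).1).
pose p0 := Feq a tzero.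
have p0E (x : nstruct) (v : vars x) : sat v p0 <-> vval v a = 0.
  rewrite -(val_zero v) /vval; split=> [/= ->//|h].
  by rewrite /= -(neiK (eval_term v a)) h neiK.
have pq0 x (v : vars x) : vval v a = 0 -> pv v q = pv v (take e q).
  move=> a0; apply/polyP => i; rewrite !coef_pv.
  case: (ltngtP i e) => hi; first by rewrite nth_take.
    by rewrite !nth_default ?size_take ?hq' ?ltnSn // ltnW.
  by rewrite hi -/a a0 nth_default ?val_zero // size_take hq' ltnSn.
have pq1 x (v : vars x) : vval v a != 0 -> pv v q != 0.
  by apply: contraNneq => h; rewrite -coef_pv h coef0.
apply: (@definable_ext _ _ _ (fun x v =>
  (sat v p0 /\ exists b, pv v (take e q) != 0 /\ root (pv v (take e q)) b /\
    forall i, (i < k)%N -> nrv m (pv v (g i)).[b] = eval_term v (eta i)) \/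
  (sat v (Fnot p0) /\ exists y, (true -> root (pv v q) y) /\
    forall i, (i < k)%N -> nrv m (pv v (kr i).2).[y] = eval_term v (eta' i)))).
  move=> x v.
  have E b : vval v a != 0 -> root (pv v q) b ->
     ((forall i, (i < k)%N -> nrv m (pv v (kr i).2).[b] = eval_term v (eta' i)) <->
      (forall i, (i < k)%N -> nrv m (pv v (g i)).[b] = eval_term v (eta i))).
    move=> a0 rb.
    have E1 i : eval_term v (eta' i) =
        mulRV (eval_term v (eta i)) (nrv m (vval v a ^+ (kr i).1)).
      by rewrite -powRV_rv -eval_trv -eval_rpow.
    split=> h i ik; have := h i ik.
      rewrite E1 (proj2 (krP i)) //; have [c <-] := nrv_surj (eval_term v (eta i)).
      rewrite mulRV_rv => /nrvE h'; apply/nrvE.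
      apply: rv_eq_mulI h'; [exact: nVR|exact: nch0|].
      by rewrite expf_neq0.
    by rewrite E1 (proj2 (krP i)) // => <-; rewrite mulRV_rv.
  split=> [[[/p0E a0]|[na [b [rb hb]]]]|[b [q0 [rb hb]]]].
  - by rewrite -pq0.
  - have a0 : vval v a != 0 by apply/eqP => /p0E.
    by exists b; split; [exact: pq1|split; [exact: rb|apply/E => //; exact: rb]].
  have [a0|a0] := eqVneq (vval v a) 0; [left|right].
    by split; [exact/p0E|exists b; rewrite -pq0].
  split; first by move/p0E => h; rewrite h eqxx in a0.
  by exists b; split=> //; apply/E.
apply: definable_or; apply: definable_and; try exact: definable_qf.
  apply: IH; by rewrite size_take hq' ltnSn.
by apply: definable_step IH => [|i]; [rewrite hq'|case: (krP i)].
Qed.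

Lemma definable_exists_VF k (n : nat -> nat) m (g : nat -> seq (tm VF)) :
  (forall i, ((n i).+1 %| m.+1)%N) ->
  def (fun x v => exists y, forall i, (i < k)%N ->
    nrv (n i) (pv v (g i)).[y] = v (RV (n i)) i).
Proof.
move=> hn; pose e := \max_(i < k) size (g i).
pose g' i := if (i < k)%N then g i else [::].
have hg i : (size (g' i) <= e)%N.
  rewrite /g'; case: ifP => // ik.
  exact: (@leq_bigmax _ (fun i : 'I_k => size (g i)) (Ordinal ik)).
(* The premise [false] and the empty polynomial match the elimination step without an equation; the
   sequence [Z] lifts all prescribed classes to the common level $m+1$. *)
pose R (x : nstruct) (v : vars x) (Z : nat -> car Lbase x (RV m)) :=
  (exists y, (false -> root (pv v [::]) y) /\
    forall i, (i < k)%N -> nrv m (pv v (g' i)).[y] = Z i) /\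
  (forall i, (i < k)%N -> resRV (hn i) (Z i) = v (RV (n i)) i).
apply: (@definable_ext _ _ _ (fun x v => exists Z, R x v Z)).
  move=> x v; split=> [[Z [[y [_ h1]] h2]]|[y h]].
    exists y => i ik; rewrite -(h2 i ik) -(h1 i ik) resRV_rv.
    by rewrite /g' ik.
  exists (fun i => nrv m (pv v (g' i)).[y]); split; first by exists y.
  by move=> i ik; rewrite resRV_rv /g' ik h.
apply: (@definable_existsZ _ _ _ m k R) => [x v w Z [a1 a2] [[y [_ h1]] h2]|].
  split; last by move=> i ik; rewrite a2 // h2.
  by exists y; split=> // i ik; rewrite (pv_agree _ a1) h1.
apply: definable_and.
  apply: (@definable_step e k m false [::] g' (fun i => tvar (RV m) (k + i)%N)) => //.
  exact: definable_roots.
apply: definable_all => i _.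
exact: (@definable_qf _ _ _
  (Feq (rres (hn i) (tvar (RV m) (k + i)%N)) (tvar (RV (n i)) i))).
Qed.

(** * Transfer to models of T *)

Section Closure.
Variable E : expansion.

Definition close (L : list (Defs.sort * nat)) (p : formula E) :=
  foldr (fun sk q => Fall sk.1 sk.2 q) p L.

Lemma sat_close (M : structure E) L p :
  (forall v : assignment M, sat v (close L p)) <->
  (forall v : assignment M, sat v p).
Proof.
elim: L => //= [[s k] L [IH1 IH2]]; split=> h v.
  apply: IH1 => {}v; have := h v (v s k).
  by rewrite (@upd_all _ _ _ _ _ _ v).
by move=> a; apply: IH2.
Qed.

Lemma same_varP s k s' k' : reflect ((s, k) = (s', k')) (same_var s k s' k').
Proof.
rewrite /same_var; case: sort_eq_dec => [e|ne] /=; first rewrite e.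
  by apply: (iffP eqP) => [->|[]].
by constructor => -[].
Qed.

Lemma free_list (p : formula E) : exists L : list (Defs.sort * nat),
  forall s k, Defs.free s k p -> List.In (s, k) L.
Proof.
have [ht hts] : (forall s' (t : term E s'), exists L : list (Defs.sort * nat),
    forall s k, occ_term s k t -> List.In (s, k) L) /\
  (forall ss (ts : targs E ss), exists L : list (Defs.sort * nat),
    forall s k, occ_targs s k ts -> List.In (s, k) L).
  apply: term_targs_ind => //=.
  - move=> s k; exists [:: (s, k)] => s' k' /same_varP ->; by left.
  - by exists [::].
  - move=> s ss t [L1 h1] ts [L2 h2]; exists (L1 ++ L2) => s' k' /orP h.
    by apply/List.in_or_app; case: h => [/h1|/h2]; [left|right].
elim: p => //=.
- by exists [::].
- by exists [::].
- move=> s t u; have [L1 h1] := ht s t; have [L2 h2] := ht s u.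
  exists (L1 ++ L2) => s' k' /orP h.
  by apply/List.in_or_app; case: h => [/h1|/h2]; [left|right].
- move=> p [L1 h1] q [L2 h2]; exists (L1 ++ L2) => s' k' /orP h.
  by apply/List.in_or_app; case: h => [/h1|/h2]; [left|right].
- move=> p [L1 h1] q [L2 h2]; exists (L1 ++ L2) => s' k' /orP h.
  by apply/List.in_or_app; case: h => [/h1|/h2]; [left|right].
- by move=> s k p [L h]; exists L => s' k' /andP [_ /h].
- by move=> s k p [L h]; exists L => s' k' /andP [_ /h].
Qed.

Lemma free_close L p s k :
  Defs.free s k (close L p) -> Defs.free s k p /\ ~ List.In (s, k) L.
Proof.
elim: L => [|[s' k'] L IH] /=; first by split.
move=> /andP [/same_varP ne /IH [h1 h2]]; split=> // -[e|//].
by apply: ne; rewrite e.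
Qed.

Lemma closed_closure p : exists L, sentence (close L p).
Proof.
have [L h] := free_list p; exists L => s k; apply/negP => /free_close [h1].
by apply; exact: h.
Qed.

End Closure.

Lemma embed_close E L p : embed E (close L p) = close L (embed E p).
Proof. by elim: L => //= a L ->. Qed.
Lemma embed_exs E L p : embed E (exs L p) = exs L (embed E p).
Proof. by elim: L => //= a L ->. Qed.
Lemma qf_embed E p : qf (embed E p) = qf p.
Proof. by elim: p => //= [[]//|p -> q ->|p -> q ->]. Qed.

Section Conjunction.
Variables (E : expansion) (f : nat -> formula E).
Fixpoint conj k := if k is k'.+1 then Fand (conj k') (f k') else Ftrue.

Lemma sat_conj (M : structure E) (v : assignment M) k :
  sat v (conj k) <-> forall i, (i < k)%N -> sat v (f i).
Proof.
elim: k => [|k IH] /=; first by split.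
rewrite IH; split=> [[h1 h2] i|h].
  by rewrite ltnS leq_eqVlt => /orP [/eqP ->|/h1].
by split=> [i hi|]; apply: h => //; exact: ltnW.
Qed.
End Conjunction.

Lemma embed_conj E f k : embed E (conj f k) = conj (fun i => embed E (f i)) k.
Proof. by elim: k => //= k ->. Qed.

Definition hterm E (g : seq (term E VF)) (t : term E VF) :=
  foldr (fun c acc => tadd c (tmul acc t)) tzero g.

Lemma val_hterm (x : nstruct) (v : vars x) g t :
  vval v (hterm g t) = (pv v g).[vval v t].
Proof.
have -> : pv v g = Poly [seq vval v c | c <- g].
  apply/polyP => i; rewrite coef_pv coef_Poly.
  case: (ltnP i (size g)) => h; first by rewrite (nth_map tzero).
  by rewrite !nth_default ?size_map // val_zero.
rewrite horner_Poly; elim: g => [|c g IH] /=; first exact: val_zero.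
by rewrite val_add val_mul IH addrC.
Qed.

Section TermInduction.
Variable E : expansion.

Fixpoint tall (P : forall s, term E s -> Prop) ss (ts : targs E ss) : Prop :=
  match ts with tnil => True | tcons _ _ t ts' => P _ t /\ tall P ts' end.

Lemma term_nested_ind (P : forall s, term E s -> Prop) :
  (forall s k, P s (tvar s k)) ->
  (forall f ts, tall P ts -> P _ (tapp f ts)) -> forall s t, P s t.
Proof.
move=> hv ha.
by have [h _] : (forall s t, P s t) /\ (forall ss ts, @tall P ss ts);
  [apply: term_targs_ind|].
Qed.

Lemma targs_inv ss (ts : targs E ss) :
  match ss return targs E ss -> Prop with
  | [::] => fun ts => ts = tnil
  | s :: ss' => fun ts => exists t ts', ts = tcons t ts'
  end ts.
Proof. by case: ts => // s ss' t ts'; exists t, ts'. Qed.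

Lemma targs0 (ts : targs E [::]) : ts = tnil.
Proof. exact: (targs_inv ts). Qed.
Lemma targs1 s (ts : targs E [:: s]) : exists t, ts = tcons t tnil.
Proof.
have [t [ts' ->]] := targs_inv ts; exists t; by rewrite (targs0 ts').
Qed.
Lemma targs2 s s' (ts : targs E [:: s; s']) : exists t u, ts = tcons t (tcons u tnil).
Proof.
have [t [ts' ->]] := targs_inv ts; have [u ->] := targs1 ts'; by exists t, u.
Qed.
End TermInduction.

Section Transfer.
Variables (E : expansion) (T : formula E -> Prop).
Hypothesis hT : forall p : formula Lbase, THen0 p -> T (embed E p).

(** The universal closure of [p] is a sentence true in all natural structures, so its embedding
    belongs to [T]. *)
Lemma transfer p : (forall (x : nstruct) (v : vars x), sat v p) ->
  forall M, model T M -> forall v : assignment M, sat v (embed E p).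
Proof.
move=> h M hM; have [L hL] := closed_closure p.
apply/(sat_close M L); rewrite -embed_close; apply: hM; apply: hT.
split=> // M0 /natural_nstruct [x <-]; rewrite /models; apply/sat_close; exact: h.
Qed.

Lemma transfer_iff p q : (forall (x : nstruct) (v : vars x), sat v p <-> sat v q) ->
  forall M, model T M -> forall v : assignment M,
  sat v (embed E p) <-> sat v (embed E q).
Proof.
move=> h M hM v.
have := @transfer (Fand (For (Fnot p) q) (For (Fnot q) p)) _ M hM v.
move=> /(_ _) [|/= h1 h2]; last by tauto.
move=> x w /=; have := h x w; have := classic (sat w p).
have := classic (sat w q); tauto.
Qed.

(** * Polynomial arithmetic in models of T *)

Section Ring.
Variable M : structure E.
Hypothesis hM : model T M.
Local Notation F := (car E M VF).
Let zero : F := fint E M (Fb VFzero) tt.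
Let one : F := fint E M (Fb VFone) tt.
Let add (a b : F) : F := fint E M (Fb VFadd) (a, (b, tt)).
Let mul (a b : F) : F := fint E M (Fb VFmul) (a, (b, tt)).
Let opp (a : F) : F := fint E M (Fb VFopp) (a, tt).
Let asg (l : seq F) : assignment M := fun s k =>
  match s with VF => nth zero l k | RV n => inh M (RV n) end.

(** Models of [T] come with no field structure at hand. The identities needed to compute with Horner
    sums are therefore imported one by one, each as an equation between two terms of the base
    language. *)
Let ring_transfer (t u : tm VF) l :
  (forall (x : nstruct) (v : vars x), vval v t = vval v u) ->
  eval_term (asg l) (emb_term E t) = eval_term (asg l) (emb_term E u).
Proof.
move=> h; apply: (@transfer (Feq t u)) => // x v /=.
by rewrite -(neiK (eval_term v t)) -/(vval v t) h /vval neiK.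
Qed.

Local Notation X k := (tvar VF k : tm VF).

Lemma raw_add0l a : add zero a = a.
Proof. by apply: (@ring_transfer (tadd tzero (X 0)) (X 0) [:: a]) => x v;
  rewrite !(val_add, val_zero); ring. Qed.
Lemma raw_add0r a : add a zero = a.
Proof. by apply: (@ring_transfer (tadd (X 0) tzero) (X 0) [:: a]) => x v;
  rewrite !(val_add, val_zero); ring. Qed.
Lemma raw_mul0l a : mul zero a = zero.
Proof. by apply: (@ring_transfer (tmul tzero (X 0)) tzero [:: a]) => x v;
  rewrite !(val_mul, val_zero); ring. Qed.
Lemma raw_mul0r a : mul a zero = zero.
Proof. by apply: (@ring_transfer (tmul (X 0) tzero) tzero [:: a]) => x v;
  rewrite !(val_mul, val_zero); ring. Qed.
Lemma raw_mul1l a : mul one a = a.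
Proof. by apply: (@ring_transfer (tmul tone (X 0)) (X 0) [:: a]) => x v;
  rewrite !(val_mul, val_one); ring. Qed.
Lemma raw_opp0 : opp zero = zero.
Proof. by apply: (@ring_transfer (topp tzero) tzero [::]) => x v;
  rewrite !(val_opp, val_zero); ring. Qed.
Lemma raw_add_horner a p b q y :
  add (add a (mul p y)) (add b (mul q y)) = add (add a b) (mul (add p q) y).
Proof. by apply: (@ring_transfer
  (tadd (tadd (X 0) (tmul (X 1) (X 4))) (tadd (X 2) (tmul (X 3) (X 4))))
  (tadd (tadd (X 0) (X 2)) (tmul (tadd (X 1) (X 3)) (X 4))) [:: a; p; b; q; y])
  => x v; rewrite !(val_add, val_mul); ring. Qed.
Lemma raw_scale_horner c a p y :
  mul c (add a (mul p y)) = add (mul c a) (mul (mul c p) y).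
Proof. by apply: (@ring_transfer
  (tmul (X 0) (tadd (X 1) (tmul (X 2) (X 3))))
  (tadd (tmul (X 0) (X 1)) (tmul (tmul (X 0) (X 2)) (X 3))) [:: c; a; p; y])
  => x v; rewrite !(val_add, val_mul); ring. Qed.
Lemma raw_mul_horner a p q y :
  mul (add a (mul p y)) q = add (mul a q) (add zero (mul (mul p q) y)).
Proof. by apply: (@ring_transfer
  (tmul (tadd (X 0) (tmul (X 1) (X 3))) (X 2))
  (tadd (tmul (X 0) (X 2)) (tadd tzero (tmul (tmul (X 1) (X 2)) (X 3))))
  [:: a; p; q; y])
  => x v; rewrite !(val_add, val_mul, val_zero); ring. Qed.
Lemma raw_opp_horner a p y :
  opp (add a (mul p y)) = add (opp a) (mul (opp p) y).
Proof. by apply: (@ring_transfer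
  (topp (tadd (X 0) (tmul (X 1) (X 2))))
  (tadd (topp (X 0)) (tmul (topp (X 1)) (X 2))) [:: a; p; y])
  => x v; rewrite !(val_add, val_mul, val_opp); ring. Qed.

Lemma raw_eq a b :
  fint E M (Fb (Brv 0)) (add a (opp b), tt) = fint E M (Fb (RVzero 0)) tt <-> a = b.
Proof.
have h := @transfer_iff
  (Feq (trv 0 (tadd (X 0) (topp (X 1)))) (tapp (Fb (RVzero 0)) tnil))
  (Feq (X 0) (X 1)) _ M hM (asg [:: a; b]).
apply: h => x v; rewrite -[sat v _]/(eval_term v (trv 0 (tadd (X 0) (topp (X 1)))) =
  fint Lbase x (Fb (RVzero 0)) tt) eval_trv nrv_0 rv_eq0 val_add val_opp.
split=> [/eqP|/= h].
  rewrite subr_eq0 => /eqP h /=.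
  by rewrite -(neiK (v VF 0%N)) -[nei _]/(vval v (X 0)) h /vval neiK.
by rewrite /vval /= h subrr.
Qed.

Definition hraw (l : seq F) (y : F) : F :=
  foldr (fun c acc => add c (mul acc y)) zero l.

Lemma eval_hterm (v : assignment M) g t :
  eval_term v (hterm g t) = hraw [seq eval_term v c | c <- g] (eval_term v t).
Proof. by elim: g => //= c g ->. Qed.

Fixpoint addP (p q : seq (term E VF)) : seq (term E VF) :=
  match p, q with
  | [::], _ => q
  | _, [::] => p
  | a :: p', b :: q' => tadd a b :: addP p' q'
  end.
Definition mulP (p q : seq (term E VF)) : seq (term E VF) :=
  foldr (fun a acc => addP (map (tmul a) q) (tzero :: acc)) [::] p.

Section Eval.
Variables (v : assignment M) (y : F).
Let H p := hraw [seq eval_term v c | c <- p] y.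

Lemma hraw_addP p q : H (addP p q) = add (H p) (H q).
Proof.
rewrite /H; elim: p q => [|a p IH] [|b q] /=; rewrite ?raw_add0l ?raw_add0r //.
by rewrite IH -raw_add_horner.
Qed.
Lemma hraw_scale c p : H (map (tmul c) p) = mul (eval_term v c) (H p).
Proof.
rewrite /H; elim: p => [|a p IH] /=; first by rewrite raw_mul0r.
by rewrite IH raw_scale_horner.
Qed.
Lemma hraw_opp p : H (map (@topp E) p) = opp (H p).
Proof.
rewrite /H; elim: p => [|a p IH] /=; first by rewrite raw_opp0.
by rewrite IH raw_opp_horner.
Qed.
Lemma hraw_mulP p q : H (mulP p q) = mul (H p) (H q).
Proof.
elim: p => [|a p IH]; first by rewrite /H /= raw_mul0l.
rewrite /mulP /= -/(mulP p q) hraw_addP hraw_scale.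
have -> : H (tzero :: mulP p q) = add zero (mul (H (mulP p q)) y) by [].
by rewrite IH -raw_mul_horner.
Qed.
End Eval.
End Ring.

(** * Isolating one VF-variable in terms and formulas *)

Section Var.
Variable k0 : nat.

(** The coefficients are evaluated at [v], so [y] enters only as the argument of the Horner sum. *)
Definition is_coefs (t : term E VF) cs := forall M, model T M ->
  forall (v : assignment M) y,
  eval_term (upd v k0 y) t = hraw [seq eval_term v c | c <- cs] y.

Lemma coefs_const s (t : term E s) :
  (forall M (v w : assignment M), eval_term v t = eval_term w t) ->
  match s return term E s -> Prop with
  | VF => fun t => exists cs, is_coefs t cs | RV _ => fun=> True end t.
Proof.
case: s t => // t h; exists [:: t] => M hM v y /=.
by rewrite raw_mul0l // raw_add0r // (h M _ v).
Qed.

Lemma coefs_ex (t : term E VF) : exists cs, is_coefs t cs.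
Proof.
pose P s (t : term E s) := match s return term E s -> Prop with
  | VF => fun t => exists cs, is_coefs t cs | RV _ => fun=> True end t.
suff h : forall s t, P s t by exact: (h VF t).
apply: term_nested_ind => [[|n] k //|f ts].
  have [->|ne] := eqVneq k k0.
    exists [:: tzero; tone] => M hM v y /=; rewrite upd_same.
    by rewrite raw_mul0l // raw_add0r // raw_mul1l // raw_add0l.
  exists [:: tvar VF k] => M hM v y /=; rewrite upd_other; last first.
    by move=> [e]; rewrite e eqxx in ne.
  by rewrite raw_mul0l // raw_add0r.
case: f ts => [[]|c|g] //.
- by move=> ts _; apply: (@coefs_const _ (tapp _ ts)) => M v w; rewrite (targs0 ts).
- by move=> ts _; apply: (@coefs_const _ (tapp _ ts)) => M v w; rewrite (targs0 ts).
- move=> ts; have [t1 [t2 ->]] := targs2 ts => /= [[[c1 h1] [[c2 h2] _]]].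
  by exists (addP c1 c2) => M hM v y; rewrite hraw_addP // -h1 // -h2.
- move=> ts; have [t1 ->] := targs1 ts => /= [[[c1 h1] _]].
  by exists (map (@topp E) c1) => M hM v y; rewrite hraw_opp // -h1.
- move=> ts; have [t1 [t2 ->]] := targs2 ts => /= [[[c1 h1] [[c2 h2] _]]].
  by exists (mulP c1 c2) => M hM v y; rewrite hraw_mulP // -h1 // -h2.
- by move=> ts _; apply: (@coefs_const _ (tapp _ ts)) => M v w; rewrite (targs0 ts).
Qed.

(** Consecutive variables from index [B] on, read in [w], hold the listed classes. A second
    assignment [v] evaluates the terms, because there the eliminated variable takes the value
    [y]. *)
Fixpoint holds M (v w : assignment M) B (L : seq (nat * term E VF)) : Prop :=
  if L is (n, t) :: L' then
    w (RV n) B = fint E M (Fb (Brv n)) (eval_term v t, tt) /\ holds v w B.+1 L'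
  else True.

Lemma holds_cat M (v w : assignment M) B L1 L2 :
  holds v w B (L1 ++ L2) <-> holds v w B L1 /\ holds v w (B + size L1) L2.
Proof.
elim: L1 B => [|[n t] L1 IH] B /=; first by rewrite addn0; tauto.
by rewrite IH addSnnS; tauto.
Qed.

Lemma holdsP M (v w : assignment M) B L : holds v w B L <->
  forall i, (i < size L)%N ->
    w (RV (nth 0 (unzip1 L) i)) (B + i)%N =
    fint E M (Fb (Brv (nth 0 (unzip1 L) i))) (eval_term v (nth tzero (unzip2 L) i), tt).
Proof.
elim: L B => [|[n t] L IH] B /=; first by split.
rewrite IH; split=> [[h1 h2] [|i] hi|h]; first by rewrite addn0.
  by rewrite -addSnnS; exact: h2.
split; first by have := h 0%N isT; rewrite addn0.
by move=> i hi; rewrite addSnnS; exact: (h i.+1).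
Qed.

(* [t'] is [t] with its maximal subterms [rv_n(u)] replaced by the fresh
   variables listed, together with [u], in [L]. *)
Definition unnests s (t : term E s) B L t' :=
  forall M (w : assignment M) (y : car E M VF), holds (upd w k0 y) w B L ->
  eval_term w t' = eval_term (upd w k0 y) t.

(** Nothing is asked of VF-terms: below a symbol [Brv] the whole argument is put on the list as it
    stands. *)
Definition unnestable s : term E s -> Prop :=
  match s return term E s -> Prop with
  | VF => fun=> True
  | RV n => fun t => forall B, exists L t', unnests t B L t' end.

Lemma unnestable_any s (t : term E s) :
  (forall B, exists L t', unnests t B L t') -> unnestable t.
Proof. by case: s t. Qed.

Lemma unnest_targs ss (ts : targs E ss) : tall unnestable ts ->
  all (fun s => ~~ is_VF s) ss -> forall B, exists L ts',
  forall M (w : assignment M) (y : car E M VF), holds (upd w k0 y) w B L ->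
  eval_targs w ts' = eval_targs (upd w k0 y) ts.
Proof.
elim: ss ts => [|s ss IH] ts.
  by rewrite (targs0 ts) => _ _ B; exists [::], tnil.
have [t [ts' ->]] := targs_inv ts => /= [[ht hts]] /andP [hs hss] B.
have {}ht : exists L t', unnests t B L t' by case: (s) t hs ht => // n t _; apply.
have [L1 [t1 h1]] := ht; have [L2 [ts2 h2]] := IH ts' hts hss (B + size L1)%N.
exists (L1 ++ L2), (tcons t1 ts2) => M w y /holds_cat [/h1 e1 /h2 e2] /=.
by rewrite e1 e2.
Qed.

Lemma unnestable_app f (ts : targs E (fargs f)) :
  tall unnestable ts -> all (fun s => ~~ is_VF s) (fargs f) ->
  unnestable (tapp f ts).
Proof.
move=> h1 h2; apply: unnestable_any => B.
have [L [ts' h]] := unnest_targs h1 h2 B.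
by exists L, (tapp f ts') => M w y hw /=; rewrite (h M w y).
Qed.

Lemma unnest_term s (t : term E s) : unnestable t.
Proof.
move: s t; apply: term_nested_ind => [[|n] k //|f ts].
  move=> B; exists [::], (tvar (RV n) k) => M w y _ /=.
  by rewrite upd_other.
case: f ts => [[]|c|g] //; try by move=> *; exact: unnestable_app.
- move=> n ts _ B; have [t ->] := targs1 ts.
  by exists [:: (n, t)], (tvar (RV n) B) => M w y /= [].
- move=> ts h; apply: unnestable_app => //=.
  by elim: (ef_args g).
Qed.

(** Each fresh variable is forced to equal the term it replaces, so the translation is an
    equivalence and passes through negations. *)
Lemma unnest_form (p : formula E) : qf p -> forall B, exists L p', qf p' /\
  forall M, model T M -> forall (w : assignment M) (y : car E M VF),
  holds (upd w k0 y) w B L ->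
  (sat w p' <-> sat (upd w k0 y) p).
Proof.
elim: p => //=.
- by move=> _ B; exists [::], Ftrue.
- by move=> _ B; exists [::], Ffalse.
- case=> [|n] t u _ B.
    exists [:: (0%N, tadd t (topp u))],
      (Feq (tvar (RV 0) B) (tapp (Fb (RVzero 0)) tnil)).
    split=> // M hM w y /= [-> _].
    exact: raw_eq.
  have [L1 [t1 h1]] := unnest_term t B.
  have [L2 [t2 h2]] := unnest_term u (B + size L1)%N.
  exists (L1 ++ L2), (Feq t1 t2); split=> // M hM w y /holds_cat [/h1 e1 /h2 e2] /=.
  by rewrite e1 e2.
- move=> r ts _ B.
  have ha : tall unnestable ts.
    by elim: {r} (rargs r) / ts => //= s ss t ts IH; split=> //; exact: unnest_term.
  have [|L [ts' h]] := unnest_targs ha _ B.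
    case: r {ts ha} => [[n|n|n d]|g] //=; last by elim: (er_args g).
    by elim: d.
  by exists L, (@Frel E r ts'); split=> // M hM w y hw /=; rewrite (h M w y).
- move=> p IH /IH {}IH B; have [L [p' [q' h]]] := IH B.
  exists L, (Fnot p'); split=> // M hM w y hw /=.
  by have := h M hM w y hw; tauto.
- move=> p IHp q IHq /andP [/IHp {}IHp /IHq {}IHq] B.
  have [L1 [p' [qp h1]]] := IHp B; have [L2 [q' [qq h2]]] := IHq (B + size L1)%N.
  exists (L1 ++ L2), (Fand p' q'); split; first by rewrite /= qp.
  move=> M hM w y /holds_cat [/(h1 M hM) e1 /(h2 M hM) e2] /=; tauto.
- move=> p IHp q IHq /andP [/IHp {}IHp /IHq {}IHq] B.
  have [L1 [p' [qp h1]]] := IHp B; have [L2 [q' [qq h2]]] := IHq (B + size L1)%N.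
  exists (L1 ++ L2), (For p' q'); split; first by rewrite /= qp.
  move=> M hM w y /holds_cat [/(h1 M hM) e1 /(h2 M hM) e2] /=; tauto.
Qed.
End Var.

Definition mods := {M : structure E | model T M}.
Definition mstr (x : mods) : structure E := sval x.
Local Notation defT := (@definable E mods mstr).

(* The coefficients of the polynomials become the VF-variables of index
   [(i * W + j).+1], the variable 0 being the one to eliminate. *)
Lemma definable_raw B (L : seq nat) (css : seq (seq (term E VF))) :
  defT (fun x v => exists y, forall i, (i < size L)%N ->
    v (RV (nth 0 L i)) (B + i)%N = fint E (mstr x) (Fb (Brv (nth 0 L i)))
      (hraw [seq eval_term v c | c <- nth [::] css i] y, tt)).
Proof.
pose k := size L; pose n i := nth 0 L i.
pose m := (\prod_(j <- L) j.+1).-1.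
have hm i : ((n i).+1 %| m.+1)%N.
  rewrite /m prednK; last by rewrite prodn_gt0.
  rewrite /n; elim: L {k n m} i => [|a L IH] [|i] //=; rewrite big_cons.
    by rewrite dvdn_mulr.
  by rewrite dvdn_mull.
(* Exceeds the length of every coefficient list, so that [i * W + j] determines [i] and [j]. *)
pose W := (\max_(c <- css) size c).+1.
have hW i : (size (nth [::] css i) < W)%N.
  rewrite /W ltnS; elim: (css) i => [|c l IH] [|i] //=; rewrite big_cons.
    exact: leq_maxl.
  by rewrite (leq_trans (IH i)) // leq_maxr.
pose g i := mkseq (fun j => tvar VF (i * W + j).+1 : tm VF) (size (nth [::] css i)).
have [p0 [B0 [q0 d0]]] := @definable_exists_VF k n m g hm.
have q1 : qf (embed E p0) by rewrite qf_embed.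
pose A i := Feq (trv (n i) (hterm (g i) (tvar VF 0))) (tvar (RV (n i)) i).
pose eA := Fex VF 0 (conj A k).
have [L0 hL0] := exists_agree_exs B0 q0.
have [L1 hL1] := exists_agree_exs B0 q1.
pose LL := [seq nk <- L0 ++ L1 | (B0 <= nk.2)%N].
(* With generic coefficients both sides are formulas of the base language, equivalent in all natural
   structures. The common prefix [LL] turns the right side into a single formula both before and
   after embedding. *)
have tr M (hM : model T M) (u : assignment M) :
    sat u (embed E eA) <-> exists w, agree B0 u w /\ sat w (embed E p0).
  rewrite -(hL1 (L0 ++ L1)); last by move=> a h; rewrite mem_cat h orbT.
  rewrite -/LL -embed_exs; apply: transfer_iff => // x v.
  rewrite hL0; last by move=> a h; rewrite mem_cat h.
  rewrite -d0 /eA /=.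
  have E1 (a : nK x) i : (pv (upd v 0%N (ne a : car Lbase x VF)) (g i)) = pv v (g i).
    apply/polyP => j; rewrite !coef_pv.
    case: (ltnP j (size (nth [::] css i))) => h.
      by rewrite /vval !nth_mkseq //= upd_other.
    by rewrite !nth_default ?size_mkseq // !val_zero.
  have E2 (a : nK x) i : sat (upd v 0%N (ne a : car Lbase x VF)) (A i) <->
      nrv (n i) (pv v (g i)).[a] = v (RV (n i)) i.
    rewrite -[sat _ _]/(eval_term (upd v 0%N (ne a : car Lbase x VF))
      (trv (n i) (hterm (g i) (tvar VF 0))) = upd v 0%N (ne a : car Lbase x VF) (RV (n i)) i).
    rewrite eval_trv val_hterm E1 upd_other //.
    by rewrite [vval _ (tvar VF 0)]/vval /= upd_same neK.
  split=> [[a /sat_conj h]|[a h]].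
    by exists (nei a) => i hi; apply/E2; rewrite neiK; exact: h.
  by exists (ne a); apply/sat_conj => i hi; apply/E2; exact: h.
(* Specialises the generic coefficients to the actual terms and moves the RV-variables up by [B].
   The term put for VF-variable 0 does not affect [eA], which binds that variable. *)
pose sg s k : term E s := match s return term E s with
  | VF => nth tzero (nth [::] css (k.-1 %/ W)) (k.-1 %% W)
  | RV n => tvar (RV n) (B + k)%N end.
have sgE M (v : assignment M) i j : (j < size (nth [::] css i))%N ->
    sub_val sg v VF (i * W + j).+1 = eval_term v (nth tzero (nth [::] css i) j).
  move=> hj; have jW := ltn_trans hj (hW i).
  by rewrite /sub_val /= modnMDl divnMDl // modn_small // divn_small // addn0.
exists (sub_form sg (embed E p0)), (B + B0)%N; split; first by rewrite qf_sub.
case=> M hM v; rewrite /mstr /= in v *.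
transitivity (sat (sub_val sg v) (embed E eA)).
  rewrite /= embed_conj.
  have E2 a i : sat (upd (sub_val sg v) 0%N a) (embed E (A i)) <->
     v (RV (n i)) (B + i)%N = fint E M (Fb (Brv (n i)))
        (hraw [seq eval_term v c | c <- nth [::] css i] a, tt).
    have e1 : emb_term E (hterm (g i) (tvar VF 0)) =
        hterm [seq emb_term E c | c <- g i] (tvar VF 0).
      by elim: (g i) => //= c l ->.
    rewrite /= e1 eval_hterm upd_other // /= upd_same.
    have -> : [seq eval_term (upd (sub_val sg v) 0%N a) c
        | c <- [seq emb_term E c | c <- g i]] =
       [seq eval_term v c | c <- nth [::] css i].
      apply: (@eq_from_nth _ a); rewrite !size_map ?size_iota // => j hj.
      rewrite (nth_map tzero) ?size_map ?size_iota //.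
      rewrite (nth_map tzero) ?size_map ?size_iota // nth_mkseq //.
      by rewrite (nth_map tzero) //= upd_other // sgE.
    split=> [<-|->] //.
  split=> [[a h]|[a /sat_conj h]].
    by exists a; apply/sat_conj => i hi; apply/E2; exact: h.
  by exists a => i hi; apply/E2; exact: h.
rewrite tr //; split=> [[w [[a1 a2] s]]|[w [[a1 a2] s]]].
  pose w' : assignment M := fun s k => match s with VF => v VF k
    | RV n => if (k < B)%N then v (RV n) k else w (RV n) (k - B)%N end.
  exists w'; split.
    split=> //= n' k' hk; rewrite /w'; case: ltnP => // hB.
    by rewrite a2 ?ltn_subLR // /sub_val /= subnKC.
  apply/sat_sub => //.
  suff -> : sub_val sg w' = w by [].
  apply: functional_extensionality_dep => s'; apply: functional_extensionality => k'.
  case: s' => [|n']; last by rewrite /sub_val /= ltnNge leq_addr /= addKn.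
  by rewrite a1 /sub_val; apply: eval_VF_only.
exists (sub_val sg w); split; last exact/sat_sub.
split=> [k'|n' k' hk]; first by rewrite /sub_val; apply: eval_VF_only.
by rewrite /sub_val /= a2 // ltn_add2l.
Qed.

(** After unnesting, the formula [p'] is evaluated without [y], so the VF-quantifier reaches only
    the list of equations in [holds], which [definable_raw] treats. *)
Lemma definable_exists_VF_qf p k0 : qf p ->
  defT (fun x v => exists y : car E (mstr x) VF, sat (upd v k0 y) p).
Proof.
move=> qp; have [B hB] := supp_form_bound qp.
have [L [p' [qp' h]]] := unnest_form k0 qp B.
have [css hcss] : exists css, forall i, (i < size L)%N ->
    is_coefs k0 (nth tzero (unzip2 L) i) (nth [::] css i).
  elim: (L) => [|[n t] l [css IH]]; first by exists [::].
  have [cs hc] := coefs_ex k0 t; exists (cs :: css) => -[|i] //=; exact: IH.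
have hag M (v w : assignment M) (y : car E M VF) : agree B v w ->
    agree B (upd v k0 y) (upd w k0 y).
  move=> [a1 a2]; split=> [j|n j hj]; last by rewrite !upd_other ?a2.
  have [->|ne] := eqVneq j k0; first by rewrite !upd_same.
  by rewrite !upd_other // => -[e]; rewrite e eqxx in ne.
apply: (@definable_ext _ _ _ (fun x v => exists w, agree B v w /\
  (sat w p' /\ exists y : car E (mstr x) VF, holds (upd w k0 y) w B L))).
  case=> M hM v; rewrite /mstr /= in v *; split.
    move=> [w [ag [s [y hy]]]]; exists y.
    apply/(hB M _ _ (hag _ _ _ y (agree_sym ag))).
    by apply/(h M hM w y hy).
  move=> [y s].
  pose w : assignment M := fun s k => match s with VF => v VF k
    | RV n => if (k < B)%N then v (RV n) k else
      fint E M (Fb (Brv n)) (eval_term (upd v k0 y) (nth tzero (unzip2 L) (k - B)), tt)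
    end.
  have ag : agree B v w by split=> //= n k ->.
  exists w; split=> //.
  have hy : holds (upd w k0 y) w B L.
    apply/holdsP => i hi; rewrite /w ltnNge leq_addr /= addKn -/w.
    by rewrite (eval_VF_only (proj1 (hag _ _ _ y ag))).
  split; last by exists y.
  by apply/(h M hM w y hy); apply/(hB M _ _ (hag _ _ _ y ag)).
apply: definable_exists_agree; apply: definable_and; first exact: definable_qf.
apply: definable_ext (definable_raw B (unzip1 L) css) => -[M hM] v.
rewrite /mstr /= in v *; rewrite size_map.
split=> [[y hy]|[y /holdsP hy]]; exists y.
  by apply/holdsP => i hi; rewrite (hcss i hi M hM); exact: hy.
by move=> i hi; rewrite -(hcss i hi M hM); exact: hy.
Qed.

(** The bound variables move up by one, freeing index [B] for the newly quantified variable; if [k]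
    is at least [B], that variable was already among the bound ones. *)
Lemma definable_existsRV n k (R : forall x, assignment (mstr x) -> Prop) : defT R ->
  defT (fun x v => exists a : car E (mstr x) (RV n), R x (upd v k a)).
Proof.
move=> [p [B [qp d]]].
pose sg s j : term E s := match s return term E s with
  | VF => tvar VF j
  | RV n' => tvar (RV n') (if (j < B)%N then
      (if (n', j) == (n, k) then B else j) else j.+1) end.
exists (sub_form sg p), B; split; first by rewrite qf_sub.
move=> x v; split=> [[a /d [w [[a1 a2] s]]]|[w [[a1 a2] /sat_sub s]]].
  pose w0 : assignment (mstr x) := fun s j => match s with VF => v VF j
    | RV n' => if (j < B)%N then v (RV n') j else w (RV n') j.-1 end.
  exists (upd w0 B a); split.
    split=> [j|n' j hj]; rewrite upd_other //=; first by rewrite hj.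
    by move=> [_ e]; rewrite e ltnn in hj.
  apply/sat_sub => //; suff -> : sub_val sg (upd w0 B a) = w by [].
  apply: functional_extensionality_dep => s'; apply: functional_extensionality => j.
  case: s' => [|n']; rewrite /sub_val /=; first by rewrite upd_other // a1 upd_other.
  case: (ltnP j B) => hj; last first.
    rewrite upd_other /=; first by rewrite ltnNge leqW.
    by move=> [_ e]; rewrite e ltnn in hj.
  rewrite (a2 _ _ hj); have [[-> ->]|ne] := eqVneq (n', j) (n, k).
    by rewrite !upd_same.
  rewrite !upd_other /= ?hj //.
    by move=> [e1 e2]; rewrite e1 e2 eqxx in ne.
  by move=> [_ e]; rewrite e ltnn in hj.
exists (w (RV n) B); apply/d; exists (sub_val sg w); split; last exact: s.
split=> [j|n' j hj]; rewrite /sub_val /=; first by rewrite upd_other.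
rewrite hj; have [[-> ->]|ne] := eqVneq (n', j) (n, k); first by rewrite upd_same.
rewrite upd_other; first by rewrite a2.
by move=> [e1 e2]; rewrite e1 e2 eqxx in ne.
Qed.

(** The VF-quantifier commutes with the existential RV-quantifiers of the defining formula, which
    leaves a quantifier-free formula beneath it. *)
Lemma definable_existsVF k (R : forall x, assignment (mstr x) -> Prop) : defT R ->
  defT (fun x v => exists a : car E (mstr x) VF, R x (upd v k a)).
Proof.
move=> [p [B [qp d]]].
apply: definable_ext (definable_exists_agree B (definable_exists_VF_qf k qp)) => x v.
split=> [[w [[a1 a2] [y s]]]|[y /d [w [[a1 a2] s]]]].
  exists y; apply/d; exists (upd w k y); split=> //.
  split=> [j|n j hj]; last by rewrite !upd_other ?a2.
  have [->|ne] := eqVneq j k; first by rewrite !upd_same.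
  by rewrite !upd_other // => -[e]; rewrite e eqxx in ne.
pose w0 : assignment (mstr x) := fun s j => match s with
  VF => v VF j | RV n => w (RV n) j end.
exists w0; split.
  by split=> //= n j hj; rewrite a2 // upd_other.
exists y; rewrite (@upd_all _ _ _ _ _ _ w) //; last by rewrite a1 upd_same.
by case=> [|n] j ne //; rewrite a1 upd_other.
Qed.

Lemma definable_existential phi : existential phi -> defT (fun x v => sat v phi).
Proof.
elim: phi => //; try by move=> *; exact: definable_qf.
move=> [|n] k p IH /= /IH {}IH; first exact: (@definable_existsVF k _ IH).
exact: (@definable_existsRV n k _ IH).
Qed.

End Transfer.

Theorem theorem6p1 (E : expansion) (T : formula E -> Prop) :
  (forall p, T p -> sentence p) ->
  (forall p : formula Lbase, THen0 p -> T (embed E p)) ->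
  forall phi : formula E, existential phi ->
  exists psi : formula E, existential_noVF psi /\
    forall M : structure E, model T M ->
      forall v : assignment M, sat v phi <-> sat v psi.
Proof.
move=> _ hT phi /(definable_existential hT) [p [B [qp d]]].
have [L hL] := exists_agree_exs B qp.
exists (exs [seq nk <- L | (B <= nk.2)%N] p); split; first exact: exs_noVF.
move=> M hM v; rewrite hL //; exact: (d (exist _ M hM) v).
Qed.
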